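(* Let $\phi:\Sigma\to Q_{h_0}\subset\mathbb{R}^{p,q}$ be a superconformal or superminimal surface with $p+q=2r+2$ even, $r\ge1$, where $r$ is its order of isotropy. Then there are a real vector-valued function $\tilde\phi$ with $\langle\tilde\phi,\tilde\phi\rangle=\epsilon=\pm1$ and a complex-valued function $q$ such that $\phi_{r+1}=q\tilde\phi$; $h_{r+1}=\epsilon q\overline q$; $q\,(dz)^{r+1}$ is a holomorphic $(r+1)$-differential; and, writing $h_i=\epsilon_ie^{2w_i}$ with $\epsilon_i=\pm1$ for $1\le i\le r$, $$2(w_i)_{z\overline z}=\frac{h_{i+1}}{h_i}-\frac{h_i}{h_{i-1}},\quad 1\le i\le r-1,\qquad 2(w_r)_{z\overline z}=\frac{\epsilon q\overline q}{h_r}-\frac{h_r}{h_{r-1}}$$ (a real form of the affine Toda equations for the affine Dynkin diagram $D^{(2)}_{r+1}$). The superminimal case corresponds to $q=0$.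
   Context: $\mathbb{R}^{p,q}$ is $\mathbb{R}^{p+q}$ with a bilinear form $\langle\,,\,\rangle$ of signature $(p,q)$, extended complex bilinearly (the integer $q$ in $\mathbb{R}^{p,q}$ is unrelated to the function $q$). $Q_{h_0}=\{x\in\mathbb{R}^{p,q}\mid\langle x,x\rangle=h_0\}$ with $h_0=\pm1$. $\Sigma$ is a connected oriented surface. A minimal surface $\phi:\Sigma\to Q_{h_0}$ is an immersion sending each tangent space to a positive definite subspace of $\mathbb{R}^{p,q}$ which is harmonic for the induced metric; $\Sigma$ is regarded as a Riemann surface via the induced conformal structure. Subscripts $z,\overline z$ denote partial derivatives with respect to a local holomorphic coordinate $z$. Regard $\phi$ as an $\mathbb{R}^{p,q}$-valued function. Define $\phi_0=\phi$, $\phi_1=\phi_z$ and, as long as $h_i=\langle\phi_i,\overline{\phi_i}\rangle$ is non-vanishing, $$\phi_{i+1}=(\phi_i)_z-\frac{\langle(\phi_i)_z,\overline{\phi_i}\rangle}{h_i}\phi_i .$$ $\phi$ has isotropy of order $r\ge 1$ if $\phi_0,\dots,\phi_{r+1}$ can be constructed (so $h_1,\dots,h_r$ are non-vanishing) and $\langle\phi_i,\phi_i\rangle=0$ for $1\le i\le r$. Let $h_{r+1}=\langle\phi_{r+1},\overline{\phi_{r+1}}\rangle$. A minimal surface with isotropy of order $r$ and $p+q=2r+2$ (or $2r+3$) is called superminimal if $h_{r+1}=0$ and superconformal if $h_{r+1}\neq0$. *)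

(* Defs.v *)
From HB Require Import structures.
From mathcomp Require Import all_boot all_order all_algebra.
From mathcomp Require Import complex.
From mathcomp Require Import all_classical all_reals all_analysis.
Import numFieldNormedType.Exports.
Import Order.TTheory GRing.Theory Num.Theory.

Set Implicit Arguments.
Unset Strict Implicit.
Unset Printing Implicit Defensive.

Local Open Scope classical_set_scope.
Local Open Scope ring_scope.
Local Open Scope complex_scope.

(* The coordinate plane is R * R; a function on an open subset U of it is a
   total function of which only the restriction to U matters.  R[i] is only
   normed over itself in the library, so real partial derivatives are taken
   on R * R, and complex derivatives on R[i] through toC and ofC. *)
Notation plane R := (R * R)%type.

Definition toC (R : realType) (u : plane R) : R[i] := u.1 +i* u.2.
Definition ofC (R : realType) (z : R[i]) : plane R :=
  (complex.Re z, complex.Im z).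

Definition dX (R : realType) (f : plane R -> R) (u : plane R) : R :=
  'D_((1, 0) : plane R) f u.
Definition dY (R : realType) (f : plane R -> R) (u : plane R) : R :=
  'D_((0, 1) : plane R) f u.

Fixpoint Ck (R : realType) (k : nat) (U : set (plane R)) (f : plane R -> R)
    : Prop :=
  match k with
  | 0 => forall u, U u -> {for u, continuous f}
  | k'.+1 => [/\ forall u, U u -> differentiable f u,
                 Ck k' U (dX f) & Ck k' U (dY f)]
  end.

Definition smooth_on (R : realType) (U : set (plane R)) (f : plane R -> R)
    : Prop := forall k, Ck k U f.

Definition cdX (R : realType) (f : plane R -> R[i]) (u : plane R) : R[i] :=
  dX (fun v => complex.Re (f v)) u +i* dX (fun v => complex.Im (f v)) u.
Definition cdY (R : realType) (f : plane R -> R[i]) (u : plane R) : R[i] :=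
  dY (fun v => complex.Re (f v)) u +i* dY (fun v => complex.Im (f v)) u.

(* subscripts z and \bar z, for z = x + i y *)
Definition dz (R : realType) (f : plane R -> R[i]) (u : plane R) : R[i] :=
  (cdX f u - (0 +i* 1) * cdY f u) / 2.
Definition dzb (R : realType) (f : plane R -> R[i]) (u : plane R) : R[i] :=
  (cdX f u + (0 +i* 1) * cdY f u) / 2.

Definition vdX (R : realType) (n : nat) (F : plane R -> 'rV[R]_n)
    (u : plane R) : 'rV[R]_n := \row_j dX (fun v => F v 0 j) u.
Definition vdY (R : realType) (n : nat) (F : plane R -> 'rV[R]_n)
    (u : plane R) : 'rV[R]_n := \row_j dY (fun v => F v 0 j) u.
Definition vdz (R : realType) (n : nat) (F : plane R -> 'rV[R[i]]_n)
    (u : plane R) : 'rV[R[i]]_n := \row_j dz (fun v => F v 0 j) u.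

Definition holomorphic_on (R : realType) (U : set (plane R))
    (f : plane R -> R[i]) : Prop :=
  forall u, U u ->
    derivable ((fun z => f (ofC z)) : R[i]^o -> R[i]^o) (toC u) 1.

Definition cderiv (R : realType) (f : plane R -> R[i]) (u : plane R) : R[i] :=
  'D_1 ((fun z => f (ofC z)) : R[i]^o -> R[i]^o) (toC u).

(* The values of cmap outside cdom, and of cinv outside cimg, are junk. *)
Record chart (R : realType) (T : topologicalType) := Chart {
  cdom : set T;
  cimg : set (plane R);
  cmap : T -> plane R;
  cinv : plane R -> T;
  cdom_open : open cdom;
  cimg_open : open cimg;
  cmap_img : forall x, cdom x -> cimg (cmap x);
  cinv_dom : forall u, cimg u -> cdom (cinv u);
  cmapK : forall x, cdom x -> cinv (cmap x) = x;
  cinvK : forall u, cimg u -> cmap (cinv u) = u;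
  cmap_cont : forall x, cdom x -> {for x, continuous cmap};
  cinv_cont : forall u, cimg u -> {for u, continuous cinv}
}.

(* coordinate change, from the coordinates of c to those of d *)
Definition overlap (R : realType) (T : topologicalType) (c d : chart R T)
    : set (plane R) := [set u | cimg c u /\ cdom d (cinv c u)].
Definition trans (R : realType) (T : topologicalType) (c d : chart R T)
    (u : plane R) : plane R := cmap d (cinv c u).

Definition jacobian (R : realType) (g : plane R -> plane R) (u : plane R) : R :=
  dX (fun v => (g v).1) u * dY (fun v => (g v).2) u
  - dY (fun v => (g v).1) u * dX (fun v => (g v).2) u.

Definition oriented_compat (R : realType) (T : topologicalType)
    (c d : chart R T) : Prop :=
  [/\ smooth_on (overlap c d) (fun u => (trans c d u).1),
      smooth_on (overlap c d) (fun u => (trans c d u).2)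
    & forall u, overlap c d u -> 0 < jacobian (trans c d) u].

Definition covers (R : realType) (T : topologicalType) (A : set (chart R T))
    : Prop := forall x : T, exists2 c, A c & cdom c x.

Definition maximal_oriented_atlas (R : realType) (T : topologicalType)
    (A : set (chart R T)) : Prop :=
  [/\ covers A,
      forall c d, A c -> A d -> oriented_compat c d
    & forall c, (forall d, A d -> oriented_compat c d /\ oriented_compat d c) ->
        A c].

Definition connected_oriented_surface (R : realType) (T : topologicalType)
    (A : set (chart R T)) : Prop :=
  [/\ hausdorff_space T, @second_countable T, connected [set: T]
    & maximal_oriented_atlas A].

Definition complex_atlas (R : realType) (T : topologicalType)
    (Z : set (chart R T)) : Prop :=
  covers Z /\
  forall c d, Z c -> Z d ->
    holomorphic_on (overlap c d) (fun u => toC (trans c d u)).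

(* sum over the charts z of q_z (dz)^k, where q_z = q c for z = cmap c *)
Definition holomorphic_differential (R : realType) (T : topologicalType)
    (Z : set (chart R T)) (k : nat) (q : chart R T -> plane R -> R[i]) : Prop :=
  (forall c, Z c -> holomorphic_on (cimg c) (q c)) /\
  (forall c d, Z c -> Z d -> forall u, overlap c d u ->
     q c u = q d (trans c d u) * cderiv (fun v => toC (trans c d v)) u ^+ k).

Definition smooth_map (R : realType) (T : topologicalType) (n : nat)
    (A : set (chart R T)) (f : T -> 'rV[R]_n) : Prop :=
  forall c, A c -> forall j, smooth_on (cimg c) (fun u => f (cinv c u) 0 j).

(* Bilinear form with Gram matrix G, over R or, after complexG, over R[i]. *)
Definition bform (K : comNzRingType) (n : nat) (G : 'M[K]_n) (u v : 'rV[K]_n)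
    : K := (u *m G *m v^T) 0 0.

Definition complexify (R : realType) (m n : nat) (M : 'M[R]_(m, n))
    : 'M[R[i]]_(m, n) := map_mx (fun x : R => x%:C) M.

Definition cform (R : realType) (n : nat) (G : 'M[R]_n)
    (u v : 'rV[R[i]]_n) : R[i] := bform (complexify G) u v.

Definition conjv (R : realType) (n : nat) (u : 'rV[R[i]]_n) : 'rV[R[i]]_n :=
  map_mx (fun z : R[i] => conjc z) u.

(* The rows of P are the coordinates of the standard basis in a basis which is
   orthonormal for G, with p vectors of square 1 and q of square -1. *)
Definition has_signature (R : realType) (p q : nat) (G : 'M[R]_(p + q))
    : Prop :=
  exists2 P : 'M[R]_(p + q), P \in unitmx &
    G = P *m diag_mx (\row_(j < p + q) (if (j < p)%N then 1 else - 1)) *m P^T.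

(* First fundamental form E dx^2 + 2 F dx dy + H dy^2 of a local immersion. *)
Definition ffE (R : realType) (n : nat) (G : 'M[R]_n) (f : plane R -> 'rV[R]_n)
    (u : plane R) : R := bform G (vdX f u) (vdX f u).
Definition ffF (R : realType) (n : nat) (G : 'M[R]_n) (f : plane R -> 'rV[R]_n)
    (u : plane R) : R := bform G (vdX f u) (vdY f u).
Definition ffH (R : realType) (n : nat) (G : 'M[R]_n) (f : plane R -> 'rV[R]_n)
    (u : plane R) : R := bform G (vdY f u) (vdY f u).

(* Laplace-Beltrami operator of the metric E dx^2 + 2 F dx dy + H dy^2 *)
Definition laplace_beltrami (R : realType) (E F H : plane R -> R)
    (f : plane R -> R) (u : plane R) : R :=
  let D v := Num.sqrt (E v * H v - F v ^+ 2) in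
  (dX (fun v => (H v * dX f v - F v * dY f v) / D v) u
   + dY (fun v => (E v * dY f v - F v * dX f v) / D v) u) / D u.

(* Tension field of a map into Q_{h0} for the induced metric: the component
   tangent to Q_{h0} of the Laplacian of the ambient vector-valued function
   (the normal space of Q_{h0} at f u is spanned by f u, of square h0). *)
Definition tension_field (R : realType) (n : nat) (G : 'M[R]_n) (h0 : R)
    (f : plane R -> 'rV[R]_n) (u : plane R) : 'rV[R]_n :=
  let L := \row_j laplace_beltrami (ffE G f) (ffF G f) (ffH G f)
                    (fun v => f v 0 j) u in
  L - (bform G L (f u) / h0) *: f u.

Definition minimal_surface (R : realType) (T : topologicalType) (n : nat)
    (G : 'M[R]_n) (h0 : R) (A : set (chart R T)) (phi : T -> 'rV[R]_n) : Prop :=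
  [/\ smooth_map A phi,
      forall x, bform G (phi x) (phi x) = h0
    & forall c, A c -> forall u, cimg c u ->
        let f := fun v => phi (cinv c v) in
        [/\ forall a b : R, a *: vdX f u + b *: vdY f u = 0 -> a = 0 /\ b = 0,
            forall a b : R, let X := a *: vdX f u + b *: vdY f u in
              X != 0 -> 0 < bform G X X
          & tension_field G h0 f u = 0]].

(* The oriented charts that are isothermal (conformal) for the metric induced
   by phi; they are the holomorphic coordinates of the induced Riemann surface
   structure. *)
Definition isothermal (R : realType) (T : topologicalType) (n : nat)
    (G : 'M[R]_n) (A : set (chart R T)) (phi : T -> 'rV[R]_n)
    : set (chart R T) :=
  [set c | A c /\ forall u, cimg c u ->
     let f := fun v => phi (cinv c v) in
     ffE G f u = ffH G f u /\ ffF G f u = 0].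

Fixpoint harmonic_seq (R : realType) (n : nat) (G : 'M[R]_n)
    (F : plane R -> 'rV[R[i]]_n) (i : nat) : plane R -> 'rV[R[i]]_n :=
  match i with
  | 0 => F
  | 1 => vdz F
  | i'.+1 => let Fi := harmonic_seq G F i' in
      fun u => vdz Fi u
        - (cform G (vdz Fi u) (conjv (Fi u)) / cform G (Fi u) (conjv (Fi u)))
          *: Fi u
  end.

(* phi_i and h_i in the coordinate z = cmap c *)
Definition phi_ (R : realType) (T : topologicalType) (n : nat) (G : 'M[R]_n)
    (phi : T -> 'rV[R]_n) (c : chart R T) (i : nat)
    : plane R -> 'rV[R[i]]_n :=
  harmonic_seq G (fun u => complexify (phi (cinv c u))) i.

Definition h_ (R : realType) (T : topologicalType) (n : nat) (G : 'M[R]_n)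
    (phi : T -> 'rV[R]_n) (c : chart R T) (i : nat) (u : plane R) : R[i] :=
  cform G (phi_ G phi c i u) (conjv (phi_ G phi c i u)).

(* Nonvanishing of h_1, ..., h_r is what makes phi_2, ..., phi_{r+1}
   well defined (division by 0 being total). *)
Definition isotropy (R : realType) (T : topologicalType) (n : nat)
    (G : 'M[R]_n) (A : set (chart R T)) (phi : T -> 'rV[R]_n) (r : nat)
    : Prop :=
  (1 <= r)%N /\
  forall c, isothermal G A phi c -> forall i, (1 <= i <= r)%N ->
  forall u, cimg c u ->
    h_ G phi c i u != 0 /\
    cform G (phi_ G phi c i u) (phi_ G phi c i u) = 0.

Definition superminimal (R : realType) (T : topologicalType) (n : nat)
    (G : 'M[R]_n) (h0 : R) (A : set (chart R T)) (phi : T -> 'rV[R]_n)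
    (r : nat) : Prop :=
  [/\ minimal_surface G h0 A phi, isotropy G A phi r,
      n = (2 * r + 2)%N \/ n = (2 * r + 3)%N
    & forall c, isothermal G A phi c -> forall u, cimg c u ->
        h_ G phi c r.+1 u = 0].

(* h_{r+1} <> 0 is read as an inequality of functions: h_{r+1} is not
   identically zero (it may have zeros). *)
Definition superconformal (R : realType) (T : topologicalType) (n : nat)
    (G : 'M[R]_n) (h0 : R) (A : set (chart R T)) (phi : T -> 'rV[R]_n)
    (r : nat) : Prop :=
  [/\ minimal_surface G h0 A phi, isotropy G A phi r,
      n = (2 * r + 2)%N \/ n = (2 * r + 3)%N
    & exists c, isothermal G A phi c /\
        exists2 u, cimg c u & h_ G phi c r.+1 u != 0].

(* Main.v *)
(* Write h_i = <phi_i, conj phi_i> and (phi_i)_z = phi_{i+1} + a_i phi_i.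
   Differentiating the relations <phi_i, phi_i> = 0 gives <phi_i, phi_j> = 0
   for 0 < i + j < 2r + 2.  Together with harmonicity this yields, by induction
   on i, <phi_i, conj phi_j> = 0 for i <> j, (h_i)_z = a_i h_i,
   (phi_{i+1})_zb = - (h_{i+1} / h_i) phi_i and
   (a_i)_zb = h_{i+1} / h_i - h_i / h_{i-1}; as 2 (w_i)_z = a_i, the last
   relation is the Toda equation.
   The 2r + 1 vectors phi_0, phi_i, conj phi_i (1 <= i <= r) are orthogonal for
   the Hermitian form and not isotropic, so in dimension 2r + 2 their common
   orthogonal is a line.  It contains phi_{r+1}, and it is spanned by the
   generalized cross product of the vectors.  After a normalization by
   h_1 ... h_r and by a constant, the cross product is real, has square
   h_0 sign(det G), and does not depend on the holomorphic coordinate: under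
   z -> zeta the frame is multiplied by powers of zeta_z and of its conjugate,
   whose product is the same positive factor as for h_1 ... h_r.
   This is the global section phit; q = eps <phi_{r+1}, phit> is holomorphic
   because (phi_{r+1})_zb is a multiple of phi_r and <phit, phit_zb> = 0. *)
Require Import Defs.
From HB Require Import structures.
From mathcomp Require Import all_boot all_order all_algebra.
From mathcomp Require Import ring lra zify.
From mathcomp Require Import complex.
From mathcomp Require Import all_classical all_reals all_analysis.
Import numFieldNormedType.Exports.
Import Order.TTheory GRing.Theory Num.Theory.
Set Implicit Arguments.
Unset Strict Implicit.
Unset Printing Implicit Defensive.

Local Open Scope classical_set_scope.
Local Open Scope ring_scope.
Local Open Scope complex_scope.

(** * Functions of class C^k on the plane *)

(** All the analysis is done with real partial derivatives on open subsets of the plane. Complex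
    derivability enters in two places only: the coordinate changes g of the isothermal charts, where
    it is turned into g_zb = 0, and the final claim that q is holomorphic. Two global points go
    beyond the local computation. A unit normal chosen chart by chart would have a sign ambiguity,
    with possible monodromy; the cross product involves no choice, so the local normals agree on
    overlaps and glue, without any covering argument. The signs eps_i have to be common to all
    charts: a change of coordinate multiplies h_i by a positive factor, so the sign of h_i is a
    function on the surface, locally constant because h_i is continuous and has no zero, hence
    constant by connectedness. The glued normal must also be smooth in every chart of the oriented
    atlas, not only in the isothermal ones; near each point this follows by comparison with an
    isothermal chart. *)

Section Differentiability.
Context {R : realType} {V W : normedModType R}.

Lemma differentiable_epsP (f : V -> W) (x : V) (df : {linear V -> W}) :
  continuous df ->
  (forall e : R, 0 < e ->
     \forall h \near (0 : V), `|f (h + x) - (f x + df h)| <= e * `|h|) ->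
  differentiable f x /\ 'd f x = df :> (V -> W).
Proof.
move=> dfc H.
have E : f \o shift x = cst (f x) + df +o_ (0 : V) id by apply/eqaddoP.
have D := diff_unique dfc E; split => //.
by apply/diff_locallyP; split; rewrite D.
Qed.

(** Differentiability depends only on the germ: near x the first order expansion of f is also one of
    g. The formulas for derivatives below hold only on an open set, so every induction on the class
    C^k relies on this. *)
Lemma near_eq_differentiable (f g : V -> W) (x : V) :
  (\near x, f x = g x) -> differentiable f x -> differentiable g x.
Proof.
move=> fg /diff_locallyP[dc /eqaddoP H].
have fgx := nbhs_singleton fg.
apply: (proj1 (@differentiable_epsP g x ('d f x) dc _)).
move=> e e0; have := H e e0.
have : \forall h \near (0 : V), f (h + x) = g (h + x).
  by rewrite (near_shift 0 x) in fg; apply: filterS fg => y; rewrite /= subr0.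
move=> N1 N2; apply: filterS (filterI N1 N2) => h [<-]; rewrite -fgx; exact.
Qed.
End Differentiability.

Section RealCalculus.
Context {R : realType}.
Implicit Types (U V : set (plane R)) (f g : plane R -> R) (u v : plane R).

Lemma near_open_eq (X : Type) U u (f g : plane R -> X) : open U -> U u ->
  (forall v, U v -> f v = g v) -> \near u, f u = g u.
Proof.
by move=> oU Uu fg; apply: filterS (open_nbhs_nbhs (conj oU Uu)).
Qed.

Lemma derive_open_eq (W : normedModType R) (f g : plane R -> W) U u v :
  open U -> U u -> (forall v, U v -> f v = g v) -> 'D_v f u = 'D_v g u.
Proof. by move=> oU Uu fg; apply: near_eq_derive; exact: near_open_eq fg. Qed.

Lemma dX_eq f g U u : open U -> U u -> (forall v, U v -> f v = g v) ->
  dX f u = dX g u.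
Proof. by move=> oU Uu; exact: derive_open_eq. Qed.

Lemma dY_eq f g U u : open U -> U u -> (forall v, U v -> f v = g v) ->
  dY f u = dY g u.
Proof. by move=> oU Uu; exact: derive_open_eq. Qed.

Lemma diff_plane (f : plane R -> R) u v : differentiable f u ->
  'd f u v = v.1 * dX f u + v.2 * dY f u.
Proof.
move=> df; rewrite /dX /dY !deriveE //.
have -> : v = v.1 *: ((1, 0) : plane R) + v.2 *: ((0, 1) : plane R).
  by case: v => a b; congr pair; rewrite /= /GRing.scale /= ?mulr1 ?mulr0 ?addr0 ?add0r.
by rewrite linearD !linearZ /= /GRing.scale /= !mulr1 !mulr0 ?addr0 ?add0r.
Qed.

Lemma Ck_ext k U f g : open U -> (forall u, U u -> f u = g u) ->
  Ck k U f -> Ck k U g.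
Proof.
move=> oU; elim: k f g => [|k IH] f g fg /=.
  move=> cf u Uu; rewrite /prop_for /continuous_at -(fg u Uu).
  by apply: cvg_trans (cf u Uu); apply: near_eq_cvg; exact: near_open_eq fg.
case=> df cX cY; split.
- move=> u Uu; apply: near_eq_differentiable (df u Uu); exact: near_open_eq fg.
- by apply: IH cX => u Uu; exact: dX_eq fg.
- by apply: IH cY => u Uu; exact: dY_eq fg.
Qed.

(** [Ck] imposes conditions at the points of the set on functions defined on the whole plane, so on
    a singleton it still speaks of the germ. This turns smoothness near each point into smoothness
    on U, and settles the case of an empty U. *)
Lemma Ck_pointwise k U f : (forall u, U u -> Ck k [set u] f) -> Ck k U f.
Proof.
elim: k f => [|k IH] f H /=; first by move=> u Uu; exact: (H u Uu).
split; first by move=> u Uu; have [/(_ u erefl)] := H u Uu.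
- by apply: IH => u Uu; have [_ + _] := H u Uu.
- by apply: IH => u Uu; have [_ _ +] := H u Uu.
Qed.

Lemma Ck_sub k U V f : (forall u, V u -> U u) -> Ck k U f -> Ck k V f.
Proof.
move=> VU; elim: k f => [|k IH] f /=; first by move=> H u /VU /H.
by case=> d /IH ? /IH ?; split=> // u /VU /d.
Qed.

(** The rules for products, inverses and compositions mix a function with its partial derivatives,
    so their inductions need the function itself at the lower level. *)
Lemma CkW k U f : Ck k.+1 U f -> Ck k U f.
Proof.
elim: k f => [|k IH] f.
  by case=> df _ _ u Uu; apply: differentiable_continuous; exact: df.
case=> df cX cY; split; [exact: df|exact: IH _ cX|exact: IH _ cY].
Qed.

Lemma Ck_cst k U (c : R) : Ck k U (fun=> c).
Proof.
elim: k c => [|k IH] c /=; first by move=> u _; exact: cvg_cst.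
split; first by move=> u _; exact: differentiable_cst.
- by rewrite (_ : dX _ = fun=> 0); [exact: IH|apply/funext => u; exact: derive_cst].
- by rewrite (_ : dY _ = fun=> 0); [exact: IH|apply/funext => u; exact: derive_cst].
Qed.

Lemma deriveD_diff f g u v : differentiable f u -> differentiable g u ->
  'D_v (fun x => f x + g x) u = 'D_v f u + 'D_v g u.
Proof. by move=> df dg; apply: deriveD; exact: diff_derivable. Qed.

Lemma deriveM_diff f g u v : differentiable f u -> differentiable g u ->
  'D_v (fun x => f x * g x) u = 'D_v f u * g u + f u * 'D_v g u.
Proof.
move=> df dg; rewrite (@deriveM _ _ f g); try exact: diff_derivable.
by rewrite /GRing.scale /= addrC; congr (_ + _); rewrite mulrC.
Qed.

Lemma deriveV_diff f u v : differentiable f u -> f u != 0 ->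
  'D_v (fun x => (f x)^-1) u = - (f u)^-1 * (f u)^-1 * 'D_v f u.
Proof.
move=> df f0; rewrite deriveV //; last exact: diff_derivable.
by rewrite [X in X = _]/GRing.scale /= expr2 invfM !mulNr.
Qed.

Lemma derive_comp_plane (g h : plane R -> R) f u v :
  differentiable g u -> differentiable h u -> differentiable f (g u, h u) ->
  'D_v (fun x => f (g x, h x)) u =
    'D_v g u * dX f (g u, h u) + 'D_v h u * dY f (g u, h u).
Proof.
move=> dg dh df.
have dp : differentiable (fun x => (g x, h x)) u by exact: differentiable_pair.
rewrite deriveE; last exact: (@differentiable_comp _ _ _ _ (fun x => (g x, h x)) f).
rewrite (@diff_comp _ _ _ _ (fun x => (g x, h x)) f u dp df) /=.
by rewrite diff_plane // diff_pair // !deriveE.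
Qed.

Lemma derive_comp_real (a : R -> R) f u v (l : R) :
  differentiable f u -> is_derive (f u) 1 a l ->
  differentiable (fun x => a (f x)) u /\
  'D_v (fun x => a (f x)) u = l * 'D_v f u.
Proof.
move=> df [da Da].
have da' : differentiable a (f u) by apply/derivable1_diffP.
have H := @differentiable_comp _ _ _ _ f a _ df da'.
split; first exact: H.
rewrite deriveE // (@diff_comp _ _ _ _ f a u df da') /= deriveE //.
by rewrite deriv1E // derive1E Da /GRing.scale /= mulrC.
Qed.

Lemma CkD k U f g : open U -> Ck k U f -> Ck k U g ->
  Ck k U (fun x => f x + g x).
Proof.
move=> oU; elim: k f g => [|k IH] f g /=.
  by move=> cf cg u Uu; apply: cvgD; [exact: cf|exact: cg].
case=> df fX fY [dg gX gY]; split.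
- by move=> u Uu; apply: differentiableD; auto.
- by apply: Ck_ext oU _ (IH _ _ fX gX) => u Uu; rewrite /dX deriveD_diff; auto.
- by apply: Ck_ext oU _ (IH _ _ fY gY) => u Uu; rewrite /dY deriveD_diff; auto.
Qed.

Lemma CkM k U f g : open U -> Ck k U f -> Ck k U g ->
  Ck k U (fun x => f x * g x).
Proof.
move=> oU; elim: k f g => [|k IH] f g.
  by move=> cf cg u Uu; apply: cvgM; [exact: cf|exact: cg].
move=> Cf Cg; have cf := CkW Cf; have cg := CkW Cg.
case: Cf Cg => df fX fY [dg gX gY]; split.
- by move=> u Uu; apply: differentiableM; auto.
- by apply: Ck_ext oU _ (CkD oU (IH _ _ fX cg) (IH _ _ cf gX)) => u Uu;
    rewrite /dX deriveM_diff; auto.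
- by apply: Ck_ext oU _ (CkD oU (IH _ _ fY cg) (IH _ _ cf gY)) => u Uu;
    rewrite /dY deriveM_diff; auto.
Qed.

Lemma CkV k U f : open U -> (forall u, U u -> f u != 0) -> Ck k U f ->
  Ck k U (fun x => (f x)^-1).
Proof.
move=> oU; elim: k f => [|k IH] f f0.
  by move=> cf u Uu; apply: cvgV; [exact: f0|exact: cf].
move=> Cf; have cf := CkW Cf; have ci := IH _ f0 cf.
case: Cf => df fX fY.
have cm : Ck k U (fun x => - (f x)^-1 * (f x)^-1).
  apply: (@Ck_ext _ _ (fun x => -1 * ((f x)^-1 * (f x)^-1))) => //.
    by move=> u _; rewrite mulN1r mulNr.
  by apply: CkM oU (Ck_cst _ _ _) (CkM oU ci ci).
split.
- by move=> u Uu; apply: differentiableV; auto.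
- by apply: Ck_ext oU _ (CkM oU cm fX) => u Uu; rewrite /dX deriveV_diff; auto.
- by apply: Ck_ext oU _ (CkM oU cm fY) => u Uu; rewrite /dY deriveV_diff; auto.
Qed.

Lemma Ck_ln k U f : open U -> (forall u, U u -> 0 < f u) -> Ck k U f ->
  Ck k U (fun x => ln (f x)).
Proof.
move=> oU f0; case: k => [|k] Cf.
  move=> u Uu; apply: (@continuous_comp _ _ _ f (@ln R)); first exact: Cf.
  exact: continuous_ln (f0 u Uu).
have Cv : Ck k U (fun x => (f x)^-1).
  by apply: CkV (CkW Cf) => // u /f0; rewrite lt0r => /andP[].
case: Cf => df fX fY.
have H u v : U u -> differentiable (fun x => ln (f x)) u /\
    'D_v (fun x => ln (f x)) u = (f u)^-1 * 'D_v f u.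
  by move=> Uu; apply: derive_comp_real (df u Uu) (is_derive1_ln (f0 u Uu)).
split.
- by move=> u Uu; exact: (H u 0 Uu).1.
- by apply: Ck_ext oU _ (CkM oU Cv fX) => u Uu; rewrite /dX (H _ _ Uu).2.
- by apply: Ck_ext oU _ (CkM oU Cv fY) => u Uu; rewrite /dY (H _ _ Uu).2.
Qed.

Lemma Ck_comp k U V f g h : open U -> Ck k U g -> Ck k U h -> Ck k V f ->
  (forall u, U u -> V (g u, h u)) -> Ck k U (fun x => f (g x, h x)).
Proof.
move=> oU; elim: k f g h => [|k IH] f g h.
  move=> cg ch cf UV u Uu.
  apply: (@continuous2_cvg _ _ _ _ _ _ g h (fun a b => f (a, b))).
  - rewrite (_ : (fun z => _) = f); first exact: cf (UV _ Uu).
    by apply/funext => -[].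
  - exact: cg.
  - exact: ch.
move=> Cg Ch Cf UV.
have cg := CkW Cg; have ch := CkW Ch.
case: Cg Ch Cf => dg gX gY [dh hX hY] [df fX fY].
have c1 := IH _ _ _ cg ch fX UV; have c2 := IH _ _ _ cg ch fY UV.
split.
- move=> u Uu; apply: (@differentiable_comp _ _ _ _ (fun x => (g x, h x)) f).
    by apply: differentiable_pair; auto.
  by apply: df; exact: UV.
- by apply: Ck_ext oU _ (CkD oU (CkM oU gX c1) (CkM oU hX c2)) => u Uu;
    rewrite /dX derive_comp_plane; auto.
- by apply: Ck_ext oU _ (CkD oU (CkM oU gY c1) (CkM oU hY c2)) => u Uu;
    rewrite /dY derive_comp_plane; auto.
Qed.

End RealCalculus.

(** * Symmetry of the second partial derivatives *)

Section MixedPartials.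
Context {R : realType}.
Implicit Types (U : set (plane R)) (f g : plane R -> R) (u v : plane R).

Lemma is_derive_hline f (s t : R) : differentiable f (s, t) ->
  is_derive s 1 (fun a => f (a, t)) (dX f (s, t)).
Proof.
move=> df.
have d1 : differentiable (fun a : R => (a, t)) s.
  by apply: differentiable_pair; [exact/derivable1_diffP/derivable_id|exact: differentiable_cst].
have dc := @differentiable_comp _ _ _ _ (fun a : R => (a, t)) f _ d1 df.
split; first by apply: diff_derivable; exact: dc.
rewrite deriveE // (@diff_comp _ _ _ _ (fun a : R => (a, t)) f s d1 df) /=.
rewrite diff_pair //.
rewrite diff_cst (diff_plane _ df) [X in X.1]/= [X in X.2]/= diff_val.
by rewrite (_ : (0 : R -> R) 1 = 0) // mul1r mul0r addr0.
Qed.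

Lemma is_derive_vline f (s t : R) : differentiable f (s, t) ->
  is_derive t 1 (fun a => f (s, a)) (dY f (s, t)).
Proof.
move=> df.
have d1 : differentiable (fun a : R => (s, a)) t.
  by apply: differentiable_pair; [exact: differentiable_cst|exact/derivable1_diffP/derivable_id].
have dc := @differentiable_comp _ _ _ _ (fun a : R => (s, a)) f _ d1 df.
split; first by apply: diff_derivable; exact: dc.
rewrite deriveE // (@diff_comp _ _ _ _ (fun a : R => (s, a)) f t d1 df) /=.
rewrite diff_pair //.
rewrite diff_cst (diff_plane _ df) [X in X.1]/= [X in X.2]/= diff_val.
by rewrite (_ : (0 : R -> R) 1 = 0) // mul1r mul0r add0r.
Qed.

Lemma MVT_is_derive (f df : R -> R) (a h : R) : 0 < h ->
  (forall x, a <= x <= a + h -> is_derive x 1 f (df x)) ->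
  exists2 c, a <= c <= a + h & f (a + h) - f a = df c * h.
Proof.
move=> h0 H; have ab : a < a + h by rewrite ltrDl.
have [||c] := @MVT _ f df a (a + h) ab.
- by move=> x; rewrite in_itv /= => /andP[/ltW ax /ltW xb]; apply: H; rewrite ax.
- apply: derivable_within_continuous => x; rewrite in_itv /= => Hx.
  by have [] := H x Hx.
- rewrite in_itv /= => /andP[/ltW ac /ltW cb] ->; exists c; first by rewrite ac.
  by congr (_ * _); rewrite addrC addKr.
Qed.

(** The second difference of f over a square of side h with corner u, treated by the mean value
    theorem in x then y, and in y then x, is h^2 times either mixed derivative at some point of the
    square. Both are continuous at u, so their values at u differ by at most e for every e > 0. *)
Lemma dX_dY U f u : open U -> Ck 2 U f -> U u -> dX (dY f) u = dY (dX f) u.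
Proof.
move=> oU [df [dfX _ cYX] [dfY cXY _]] Uu.
apply/eqP; rewrite -subr_eq0 -normr_eq0; apply/eqP; apply: le_anti.
rewrite normr_ge0 andbT; apply/ler_addgt0Pl => e e0; rewrite addr0.
have tri (a b c : R) : `|a - c| < e / 2 -> `|b - c| < e / 2 -> `|a - b| <= e.
  move=> ac bc; rewrite -[a](subrK c) -addrA (splitr e).
  by apply: le_trans (ler_normD _ _) _; rewrite [`|c - b|]distrC lerD // ltW.
have e20 : 0 < e / 2 by rewrite divr_gt0.
have n1 : nbhs u U by exact: open_nbhs_nbhs.
have n2 : nbhs u [set v | `|dX (dY f) u - dX (dY f) v| < e / 2].
  by have /cvgrPdist_lt := cXY u Uu; apply.
have n3 : nbhs u [set v | `|dY (dX f) u - dY (dX f) v| < e / 2].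
  by have /cvgrPdist_lt := cYX u Uu; apply.
have := filterI n1 (filterI n2 n3); clear n1 n2 n3.
case: u Uu => x y Uu N; have [d /= d0 Hd] := (@nbhs_ballP R (plane R) _ _).1 (N _ _).
have [h h0 hd] : exists2 h : R, 0 < h & h < d.
  by exists (d / 2); rewrite ?divr_gt0 // ltr_pdivrMr // ltr_pMr // ltr1n.
have box a b : x <= a <= x + h -> y <= b <= y + h ->
    U (a, b) /\ (`|dX (dY f) (x, y) - dX (dY f) (a, b)| < e / 2 /\
                 `|dY (dX f) (x, y) - dY (dX f) (a, b)| < e / 2).
  move=> /andP[a1 a2] /andP[b1 b2]; apply: (Hd (a, b)).
  by split; rewrite /ball /= ltr_distl; apply/andP; split; lra.
have xh : x < x + h by lra.
have yh : y < y + h by lra.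
have hx : x <= x <= x + h by rewrite lexx ltW.
have hx' : x <= x + h <= x + h by rewrite lexx ltW.
have hy : y <= y <= y + h by rewrite lexx ltW.
have hy' : y <= y + h <= y + h by rewrite lexx ltW.
have [c1 c1h E1] := @MVT_is_derive (fun s => f (s, y + h) - f (s, y))
  (fun s => dX f (s, y + h) - dX f (s, y)) _ _ h0
  (fun s Hs => is_deriveB (is_derive_hline (df _ (box _ _ Hs hy').1))
                          (is_derive_hline (df _ (box _ _ Hs hy).1))).
have [c2 c2h E2] := @MVT_is_derive (fun t => dX f (c1, t))
  (fun t => dY (dX f) (c1, t)) _ _ h0
  (fun t Ht => is_derive_vline (dfX _ (box _ _ c1h Ht).1)).
have [d1 d1h E3] := @MVT_is_derive (fun t => f (x + h, t) - f (x, t))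
  (fun t => dY f (x + h, t) - dY f (x, t)) _ _ h0
  (fun t Ht => is_deriveB (is_derive_vline (df _ (box _ _ hx' Ht).1))
                          (is_derive_vline (df _ (box _ _ hx Ht).1))).
have [d2 d2h E4] := @MVT_is_derive (fun s => dY f (s, d1))
  (fun s => dX (dY f) (s, d1)) _ _ h0
  (fun s Hs => is_derive_hline (dfY _ (box _ _ Hs d1h).1)).
cbv beta in E1, E2, E3, E4.
have E : dY (dX f) (c1, c2) = dX (dY f) (d2, d1).
  rewrite E2 {E2} in E1; rewrite E4 {E4} in E3.
  move: E1 E3 h0; move: (dY _ (c1, c2)) (dX _ (d2, d1)) (f _) (f _) (f _) (f _).
  clear=> A B a b c e E1 E2 h0; do 2 apply: (mulIf (lt0r_neq0 h0)).
  by rewrite -E1 -E2; ring.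
have [_ [_ B1]] := box _ _ c1h c2h.
have [_ [B2 _]] := box _ _ d2h d1h.
rewrite -E in B2; exact: tri B2 B1.
Qed.

End MixedPartials.

(** * The operators d/dz and d/d(conj z) *)

Section ComplexCalculus.
Context {R : realType}.
Implicit Types (U V : set (plane R)) (f g : plane R -> R[i]) (u v : plane R).

Lemma smooth_dX U (f : plane R -> R) : smooth_on U f -> smooth_on U (dX f).
Proof. by move=> sf k; have [] := sf k.+1. Qed.

Lemma smooth_dY U (f : plane R -> R) : smooth_on U f -> smooth_on U (dY f).
Proof. by move=> sf k; have [] := sf k.+1. Qed.

Lemma smooth_diff U (f : plane R -> R) u : smooth_on U f -> U u ->
  differentiable f u.
Proof. by move=> sf Uu; have [df _ _] := sf 1%N; exact: df. Qed.

Lemma smooth_ext U (f g : plane R -> R) : open U ->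
  (forall u, U u -> f u = g u) -> smooth_on U f -> smooth_on U g.
Proof. by move=> oU fg sf k; apply: Ck_ext fg (sf k). Qed.

Lemma smoothD U (f g : plane R -> R) : open U -> smooth_on U f ->
  smooth_on U g -> smooth_on U (fun x => f x + g x).
Proof. by move=> oU sf sg k; exact: CkD (sf k) (sg k). Qed.

Lemma smoothM U (f g : plane R -> R) : open U -> smooth_on U f ->
  smooth_on U g -> smooth_on U (fun x => f x * g x).
Proof. by move=> oU sf sg k; exact: CkM (sf k) (sg k). Qed.

Lemma smooth_cst U (c : R) : smooth_on U (fun=> c).
Proof. by move=> k; exact: Ck_cst. Qed.

Lemma smoothN U (f : plane R -> R) : open U -> smooth_on U f ->
  smooth_on U (fun x => - f x).
Proof.
move=> oU sf; apply: (@smooth_ext U (fun x => -1 * f x)) => //.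
  by move=> u _; rewrite mulN1r.
by apply: smoothM => //; exact: smooth_cst.
Qed.

Definition csmooth U f :=
  smooth_on U (fun v => complex.Re (f v)) /\
  smooth_on U (fun v => complex.Im (f v)).

Lemma ReM (x y : R[i]) :
  complex.Re (x * y) = complex.Re x * complex.Re y - complex.Im x * complex.Im y.
Proof. by case: x y => [a b] [c d]. Qed.

Lemma ImM (x y : R[i]) :
  complex.Im (x * y) = complex.Re x * complex.Im y + complex.Im x * complex.Re y.
Proof. by case: x y => [a b] [c d]. Qed.

Lemma ReD (x y : R[i]) : complex.Re (x + y) = complex.Re x + complex.Re y.
Proof. by case: x y => [a b] [c d]. Qed.

Lemma ImD (x y : R[i]) : complex.Im (x + y) = complex.Im x + complex.Im y.
Proof. by case: x y => [a b] [c d]. Qed.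

Lemma ReJ (x : R[i]) : complex.Re (conjc x) = complex.Re x.
Proof. by case: x. Qed.

Lemma ImJ (x : R[i]) : complex.Im (conjc x) = - complex.Im x.
Proof. by case: x. Qed.

Lemma complexP (x y : R[i]) : complex.Re x = complex.Re y ->
  complex.Im x = complex.Im y -> x = y.
Proof. by case: x y => [a b] [c d] /= -> ->. Qed.

Lemma complex_half (x y : R) : (x +i* y) / 2 = (x / 2) +i* (y / 2).
Proof.
have n0 : (2 : R[i]) != 0 by rewrite pnatr_eq0.
apply: (mulIf n0); rewrite divfK // mulr_natr mulr2n.
by apply: complexP; rewrite /= -splitr.
Qed.

Lemma dzE f u : dz f u =
  ((dX (fun v => complex.Re (f v)) u + dY (fun v => complex.Im (f v)) u) / 2) +i*
  ((dX (fun v => complex.Im (f v)) u - dY (fun v => complex.Re (f v)) u) / 2).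
Proof.
rewrite /dz /cdX /cdY; move: (dX _ u) (dY _ u) (dX _ u) (dY _ u) => a b c d.
by rewrite -complex_half; congr (_ / _); apply: complexP => /=; ring.
Qed.

Lemma dzbE f u : dzb f u =
  ((dX (fun v => complex.Re (f v)) u - dY (fun v => complex.Im (f v)) u) / 2) +i*
  ((dX (fun v => complex.Im (f v)) u + dY (fun v => complex.Re (f v)) u) / 2).
Proof.
rewrite /dzb /cdX /cdY; move: (dX _ u) (dY _ u) (dX _ u) (dY _ u) => a b c d.
by rewrite -complex_half; congr (_ / _); apply: complexP => /=; ring.
Qed.

Lemma csmooth_ext U f g : open U -> (forall u, U u -> f u = g u) ->
  csmooth U f -> csmooth U g.
Proof.
by move=> oU fg [rf jf]; split; [apply: smooth_ext rf|apply: smooth_ext jf];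
  move=> // u /fg ->.
Qed.

Lemma dz_ext U f g u : open U -> (forall v, U v -> f v = g v) -> U u ->
  dz f u = dz g u.
Proof.
move=> oU fg Uu; rewrite !dzE; congr ((_ + _) / _ +i* ((_ - _) / _));
  by [apply: dX_eq oU Uu _ => v /fg ->|apply: dY_eq oU Uu _ => v /fg ->].
Qed.

Lemma dzb_ext U f g u : open U -> (forall v, U v -> f v = g v) -> U u ->
  dzb f u = dzb g u.
Proof.
move=> oU fg Uu; rewrite !dzbE; congr ((_ - _) / _ +i* ((_ + _) / _));
  by [apply: dX_eq oU Uu _ => v /fg ->|apply: dY_eq oU Uu _ => v /fg ->].
Qed.

Lemma csmooth_cst U (c : R[i]) : csmooth U (fun=> c).
Proof. by split; exact: smooth_cst. Qed.

Lemma csmooth_real U (f : plane R -> R) : smooth_on U f ->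
  csmooth U (fun v => (f v)%:C).
Proof. by move=> sf; split; [exact: sf|exact: smooth_cst]. Qed.

Lemma csmooth_conj U f : open U -> csmooth U f -> csmooth U (fun v => conjc (f v)).
Proof.
move=> oU [rf jf]; split.
  by apply: smooth_ext rf => // u _; rewrite ReJ.
by apply: smooth_ext (smoothN oU jf) => // u _; rewrite ImJ.
Qed.

Lemma csmoothD U f g : open U -> csmooth U f -> csmooth U g ->
  csmooth U (fun v => f v + g v).
Proof.
move=> oU [rf jf] [rg jg]; split.
  by apply: smooth_ext (smoothD oU rf rg) => // u _; rewrite ReD.
by apply: smooth_ext (smoothD oU jf jg) => // u _; rewrite ImD.
Qed.

Lemma csmoothM U f g : open U -> csmooth U f -> csmooth U g ->
  csmooth U (fun v => f v * g v).
Proof.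
move=> oU [rf jf] [rg jg]; split.
  apply: smooth_ext (smoothD oU (smoothM oU rf rg) (smoothN oU (smoothM oU jf jg))) => // u _.
  by rewrite ReM.
apply: smooth_ext (smoothD oU (smoothM oU rf jg) (smoothM oU jf rg)) => // u _.
by rewrite ImM.
Qed.

Lemma csmoothN U f : open U -> csmooth U f -> csmooth U (fun v => - f v).
Proof.
move=> oU sf; apply: (@csmooth_ext U (fun v => -1 * f v)) => //.
  by move=> u _; rewrite mulN1r.
by apply: csmoothM => //; exact: csmooth_cst.
Qed.

Lemma csmoothB U f g : open U -> csmooth U f -> csmooth U g ->
  csmooth U (fun v => f v - g v).
Proof. by move=> oU sf sg; apply: csmoothD => //; exact: csmoothN. Qed.

Lemma complex_sqr_neq0 (x : R[i]) : x != 0 ->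
  complex.Re x ^+ 2 + complex.Im x ^+ 2 != 0.
Proof.
case: x => a b; apply: contra => /=.
by rewrite paddr_eq0 ?sqr_ge0 // !sqrf_eq0 => /andP[/eqP-> /eqP->].
Qed.

(** Writing the inverse as the conjugate over the squared modulus reduces smoothness of a complex
    inverse to that of a real one. *)
Lemma invc_real (x : R[i]) :
  x^-1 = conjc x * ((complex.Re x ^+ 2 + complex.Im x ^+ 2)^-1)%:C.
Proof.
have [->|x0] := eqVneq x 0; first by rewrite invr0 conjc0 mul0r.
have n0 := complex_sqr_neq0 x0.
apply: (mulfI x0); rewrite divff // mulrA.
have -> : x * conjc x = (complex.Re x ^+ 2 + complex.Im x ^+ 2)%:C.
  by case: x {x0 n0} => a b; apply: complexP => /=; ring.
by rewrite -rmorphM /= divff.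
Qed.

Lemma csmoothV U f : open U -> (forall u, U u -> f u != 0) -> csmooth U f ->
  csmooth U (fun v => (f v)^-1).
Proof.
move=> oU f0 sf; have [rf jf] := sf.
pose n v := (complex.Re (f v) ^+ 2 + complex.Im (f v) ^+ 2)^-1.
have sn : smooth_on U n.
  move=> k; apply: CkV => //; first by move=> u /f0; exact: complex_sqr_neq0.
  by apply: CkD => //; apply: Ck_ext (CkM oU _ _) => //; try exact: rf; try exact: jf;
    move=> u _; rewrite expr2.
apply: csmooth_ext (csmoothM oU (csmooth_conj oU sf) (csmooth_real sn)) => // u _.
by rewrite -invc_real.
Qed.

Lemma csmooth_dz U f : open U -> csmooth U f -> csmooth U (dz f).
Proof.
move=> oU [rf jf].
have s2 := @smooth_cst U (2^-1).
split.
  apply: smooth_ext (smoothM oU (smoothD oU (smooth_dX rf) (smooth_dY jf)) s2) => // u _.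
  by rewrite dzE.
apply: smooth_ext (smoothM oU (smoothD oU (smooth_dX jf) (smoothN oU (smooth_dY rf))) s2) => // u _.
by rewrite dzE.
Qed.

Lemma dz_conj f u : (exists2 U, csmooth U f & U u) ->
  dz (fun v => conjc (f v)) u = conjc (dzb f u).
Proof.
move=> [U [rf jf] Uu]; rewrite dzE dzbE.
have eR : (fun v => complex.Re (conjc (f v))) = (fun v => complex.Re (f v)).
  by apply/funext => v; rewrite ReJ.
have eI : (fun v => complex.Im (conjc (f v))) = - (fun v => complex.Im (f v)).
  by apply/funext => v; rewrite ImJ.
have dI : differentiable (fun v => complex.Im (f v)) u by exact: smooth_diff jf Uu.
rewrite eR eI; have NX : dX (- (fun v => complex.Im (f v))) u = - dX (fun v => complex.Im (f v)) u.
  by rewrite /dX deriveN //; exact: diff_derivable.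
have NY : dY (- (fun v => complex.Im (f v))) u = - dY (fun v => complex.Im (f v)) u.
  by rewrite /dY deriveN //; exact: diff_derivable.
rewrite NX NY; clear; move: (dX _ u) (dY _ u) (dX _ u) (dY _ u) => a b c d.
by apply: complexP => /=; ring.
Qed.

Lemma dzb_conj U f u : open U -> csmooth U f -> U u ->
  dzb (fun v => conjc (f v)) u = conjc (dz f u).
Proof.
move=> oU sf Uu; apply: (can_inj (@conjcK R)); rewrite conjcK -dz_conj.
  by apply: (dz_ext oU) Uu => v _; rewrite conjcK.
by exists U => //; exact: csmooth_conj.
Qed.

(** This form lets the rules for [dzb] be deduced from those for [dz] by conjugation. *)
Lemma dzbN_conj f u : (exists2 U, csmooth U f & U u) ->
  dzb f u = conjc (dz (fun v => conjc (f v)) u).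
Proof. by move=> H; rewrite dz_conj // conjcK. Qed.

Lemma dz_cst (c : R[i]) u : dz (fun=> c) u = 0.
Proof.
rewrite dzE /dX /dY !derive_cst; apply: complexP => /=; ring.
Qed.

Lemma dzb_cst (c : R[i]) u : dzb (fun=> c) u = 0.
Proof.
rewrite dzbE /dX /dY !derive_cst; apply: complexP => /=; ring.
Qed.

Lemma derive_ReD f g u (v : plane R) :
  (exists2 U, csmooth U f /\ csmooth U g & U u) ->
  'D_v (fun x => complex.Re (f x + g x)) u =
    'D_v (fun x => complex.Re (f x)) u + 'D_v (fun x => complex.Re (g x)) u /\
  'D_v (fun x => complex.Im (f x + g x)) u =
    'D_v (fun x => complex.Im (f x)) u + 'D_v (fun x => complex.Im (g x)) u.
Proof.
move=> [U [[rf jf] [rg jg]] Uu]; split.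
  rewrite -deriveD_diff; [|exact: smooth_diff rf Uu|exact: smooth_diff rg Uu].
  by congr ('D_v _ u); apply/funext => x; rewrite ReD.
rewrite -deriveD_diff; [|exact: smooth_diff jf Uu|exact: smooth_diff jg Uu].
by congr ('D_v _ u); apply/funext => x; rewrite ImD.
Qed.

Lemma derive_ReM f g u (v : plane R) :
  (exists2 U, (open U /\ csmooth U f) /\ csmooth U g & U u) ->
  'D_v (fun x => complex.Re (f x * g x)) u =
    ('D_v (fun x => complex.Re (f x)) u * complex.Re (g u)
     + complex.Re (f u) * 'D_v (fun x => complex.Re (g x)) u)
    - ('D_v (fun x => complex.Im (f x)) u * complex.Im (g u)
     + complex.Im (f u) * 'D_v (fun x => complex.Im (g x)) u) /\
  'D_v (fun x => complex.Im (f x * g x)) u =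
    ('D_v (fun x => complex.Re (f x)) u * complex.Im (g u)
     + complex.Re (f u) * 'D_v (fun x => complex.Im (g x)) u)
    + ('D_v (fun x => complex.Im (f x)) u * complex.Re (g u)
     + complex.Im (f u) * 'D_v (fun x => complex.Re (g x)) u).
Proof.
move=> [U [[oU [rf jf]] [rg jg]] Uu].
have drf := smooth_diff rf Uu; have djf := smooth_diff jf Uu.
have drg := smooth_diff rg Uu; have djg := smooth_diff jg Uu.
split.
  have d1 := smooth_diff (smoothM oU rf rg) Uu.
  have d2 := smooth_diff (smoothN oU (smoothM oU jf jg)) Uu.
  have d3 := smooth_diff (smoothM oU jf jg) Uu.
  have e3 : 'D_v (fun x => - (complex.Im (f x) * complex.Im (g x))) u =
      - 'D_v (fun x => complex.Im (f x) * complex.Im (g x)) u.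
    by rewrite (@deriveN _ _ _ (fun x => complex.Im (f x) * complex.Im (g x))) //;
      exact: diff_derivable.
  rewrite -(deriveM_diff _ drf drg) -(deriveM_diff _ djf djg) -e3 -(deriveD_diff _ d1 d2).
  by congr ('D_v _ u); apply/funext => x; rewrite ReM.
have d1 := smooth_diff (smoothM oU rf jg) Uu.
have d2 := smooth_diff (smoothM oU jf rg) Uu.
rewrite -(deriveM_diff _ drf djg) -(deriveM_diff _ djf drg) -(deriveD_diff _ d1 d2).
by congr ('D_v _ u); apply/funext => x; rewrite ImM.
Qed.

Lemma dzD U f g u : csmooth U f -> csmooth U g -> U u ->
  dz (fun v => f v + g v) u = dz f u + dz g u.
Proof.
move=> sf sg Uu; have H v := @derive_ReD f g u v (ex_intro2 _ _ U (conj sf sg) Uu).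
rewrite !dzE /dX /dY !(H _).1 !(H _).2; move: ('D_ _ _ u) ('D_ _ _ u) ('D_ _ _ u) ('D_ _ _ u) ('D_ _ _ u) ('D_ _ _ u) ('D_ _ _ u) ('D_ _ _ u).
by clear=> *; apply: complexP => /=; ring.
Qed.

Lemma dzM U f g u : open U -> csmooth U f -> csmooth U g -> U u ->
  dz (fun v => f v * g v) u = dz f u * g u + f u * dz g u.
Proof.
move=> oU sf sg Uu.
have H v := @derive_ReM f g u v (ex_intro2 _ _ U (conj (conj oU sf) sg) Uu).
rewrite !dzE /dX /dY !(H _).1 !(H _).2; move: ('D_ _ _ u) ('D_ _ _ u) ('D_ _ _ u) ('D_ _ _ u) ('D_ _ _ u) ('D_ _ _ u) ('D_ _ _ u) ('D_ _ _ u) (f u) (g u).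
by clear=> ???????? [? ?] [? ?]; apply: complexP => /=; ring.
Qed.

Lemma dzbD U f g u : open U -> csmooth U f -> csmooth U g -> U u ->
  dzb (fun v => f v + g v) u = dzb f u + dzb g u.
Proof.
move=> oU sf sg Uu; rewrite !dzbN_conj; try by exists U => //; exact: csmoothD.
rewrite -rmorphD -(@dzD U) //; try exact: csmooth_conj.
by congr conjc; apply: (dz_ext oU) Uu => v _; rewrite rmorphD.
Qed.

Lemma dzbM U f g u : open U -> csmooth U f -> csmooth U g -> U u ->
  dzb (fun v => f v * g v) u = dzb f u * g u + f u * dzb g u.
Proof.
move=> oU sf sg Uu; rewrite !dzbN_conj; try by exists U => //; exact: csmoothM.
rewrite -[in RHS](conjcK (g u)) -[in RHS](conjcK (f u)) -!rmorphM -rmorphD.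
rewrite -(@dzM U) //; try exact: csmooth_conj.
by congr conjc; apply: (dz_ext oU) Uu => v _; rewrite rmorphM.
Qed.

Lemma dz_sum U (I : finType) (f : I -> plane R -> R[i]) u : open U ->
  (forall i, csmooth U (f i)) -> U u ->
  csmooth U (fun v => \sum_i f i v) /\
  dz (fun v => \sum_i f i v) u = \sum_i dz (f i) u.
Proof.
move=> oU sf Uu.
have -> : (fun v => \sum_i f i v) = (fun v => \sum_(i <- enum I) f i v).
  by apply/funext => v; rewrite big_enum.
rewrite -big_enum /=; elim: (enum I) => [|i s [IHs IHd]].
  rewrite big_nil (_ : (fun v => _) = fun=> 0); last by apply/funext => v; rewrite big_nil.
  by split; [exact: csmooth_cst|exact: dz_cst].
have e : (fun v => \sum_(j <- i :: s) f j v) = (fun v => f i v + \sum_(j <- s) f j v).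
  by apply/funext => v; rewrite big_cons.
rewrite e big_cons -IHd -(@dzD U) //; split => //; exact: csmoothD.
Qed.

(** Both sides are a quarter of the Laplacian of f once the mixed partials of its real and imaginary
    parts are identified by [dX_dY]. *)
Lemma dz_dzb U f u : open U -> csmooth U f -> U u -> dz (dzb f) u = dzb (dz f) u.
Proof.
move=> oU [rf jf] Uu.
pose a := dX (fun v => complex.Re (f v)); pose b := dY (fun v => complex.Re (f v)).
pose c := dX (fun v => complex.Im (f v)); pose d := dY (fun v => complex.Im (f v)).
have [sa sb] : smooth_on U a /\ smooth_on U b by split; [exact: smooth_dX|exact: smooth_dY].
have [sc sd] : smooth_on U c /\ smooth_on U d by split; [exact: smooth_dX|exact: smooth_dY].
have half (g h : plane R -> R) v : smooth_on U g -> smooth_on U h ->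
    'D_v (fun x => (g x + h x) / 2) u = ('D_v g u + 'D_v h u) / 2.
  move=> sg sh; rewrite -deriveD_diff; [|exact: smooth_diff sg Uu|exact: smooth_diff sh Uu].
  rewrite deriveM_diff; [|exact: smooth_diff (smoothD oU sg sh) Uu|exact: differentiable_cst].
  by rewrite derive_cst mulr0 addr0.
have halfB (g h : plane R -> R) v : smooth_on U g -> smooth_on U h ->
    'D_v (fun x => (g x - h x) / 2) u = ('D_v g u - 'D_v h u) / 2.
  move=> sg sh; rewrite (half g (fun x => - h x)) //; last exact: smoothN.
  congr ((_ + _) / _); rewrite (@deriveN _ _ _ h) //.
  by apply: diff_derivable; exact: smooth_diff sh Uu.
rewrite [LHS]dzE [RHS]dzbE.
have -> : (fun v => complex.Re (dzb f v)) = fun x => (a x - d x) / 2.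
  by apply/funext => x; rewrite dzbE.
have -> : (fun v => complex.Im (dzb f v)) = fun x => (c x + b x) / 2.
  by apply/funext => x; rewrite dzbE.
have -> : (fun v => complex.Re (dz f v)) = fun x => (a x + d x) / 2.
  by apply/funext => x; rewrite dzE.
have -> : (fun v => complex.Im (dz f v)) = fun x => (c x - b x) / 2.
  by apply/funext => x; rewrite dzE.
have e1 : dX b u = dY a u by exact: dX_dY oU (rf 2%N) Uu.
have e2 : dX d u = dY c u by exact: dX_dY oU (jf 2%N) Uu.
have hX (g h : plane R -> R) (sg : smooth_on U g) (sh : smooth_on U h) :
    dX (fun x => (g x + h x) / 2) u = (dX g u + dX h u) / 2 := half g h (1, 0) sg sh.
have hY (g h : plane R -> R) (sg : smooth_on U g) (sh : smooth_on U h) :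
    dY (fun x => (g x + h x) / 2) u = (dY g u + dY h u) / 2 := half g h (0, 1) sg sh.
have kX (g h : plane R -> R) (sg : smooth_on U g) (sh : smooth_on U h) :
    dX (fun x => (g x - h x) / 2) u = (dX g u - dX h u) / 2 := halfB g h (1, 0) sg sh.
have kY (g h : plane R -> R) (sg : smooth_on U g) (sh : smooth_on U h) :
    dY (fun x => (g x - h x) / 2) u = (dY g u - dY h u) / 2 := halfB g h (0, 1) sg sh.
rewrite (kX a d sa sd) (hY c b sc sb) (hX c b sc sb) (kY a d sa sd).
rewrite (hX a d sa sd) (kY c b sc sb) (kX c b sc sb) (hY a d sa sd).
rewrite e1 e2; clear.
move: (dX a u) (dY a u) (dY b u) (dX c u) (dY c u) (dY d u).
by move=> *; apply: complexP => /=; ring.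
Qed.

Lemma dzV U f u : open U -> (forall v, U v -> f v != 0) -> csmooth U f -> U u ->
  dz (fun v => (f v)^-1) u = - dz f u / f u / f u.
Proof.
move=> oU f0 sf Uu; have sv := csmoothV oU f0 sf.
have : dz (fun v => f v * (f v)^-1) u = 0.
  rewrite -(dz_cst 1 u); apply: (dz_ext oU) Uu => v /f0 n0.
  by rewrite divff.
rewrite (@dzM U) // => /eqP; rewrite addr_eq0 => /eqP E.
apply: (mulfI (f0 _ Uu)); rewrite -[LHS]opprK -E mulrCA divff ?mulr1 ?mulNr //.
exact: f0.
Qed.

Lemma dz_ln U (g : plane R -> R) u : smooth_on U g -> U u -> 0 < g u ->
  dz (fun v => (ln (g v))%:C) u = dz (fun v => (g v)%:C) u / (g u)%:C.
Proof.
move=> sg Uu g0; have dg := smooth_diff sg Uu.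
have H v : 'D_v (fun x => ln (g x)) u = (g u)^-1 * 'D_v g u.
  exact: (derive_comp_real v dg (is_derive1_ln g0)).2.
rewrite !dzE /dX /dY /= !H !derive_cst.
have -> : ((g u)%:C)^-1 = ((g u)^-1)%:C by rewrite fmorphV.
move: ('D_ _ g u) ('D_ _ g u) (g u)^-1; clear=> a b c.
by apply: complexP => /=; ring.
Qed.

End ComplexCalculus.

(** * Complex derivability and the Cauchy-Riemann equation *)

Section ComplexDerivative.
Context {R : realType}.
Implicit Types (U V : set (plane R)) (f g : plane R -> R[i]) (u v : plane R).

Lemma normc_ge_Im (x : R[i]) : `|complex.Im x|%:C <= `|x|.
Proof. by rewrite normc_def lecR -sqrtr_sqr ler_wsqrtr // lerDr sqr_ge0. Qed.

Lemma normc_le_ReIm (x : R[i]) :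
  `|x| <= (`|complex.Re x| + `|complex.Im x|)%:C.
Proof.
rewrite normc_def lecR -[leRHS]ger0_norm ?addr_ge0 // -sqrtr_sqr ler_wsqrtr //.
by rewrite sqrrD !real_normK ?num_real // addrAC lerDl mulrn_wge0 // mulr_ge0.
Qed.

Lemma complex_gt0P (e : R[i]) : 0 < e -> exists2 d : R, 0 < d & e = d%:C.
Proof. by case: e => a b; rewrite ltcE /= => /andP[/eqP-> a0]; exists a. Qed.

Lemma diff_eps (f : plane R -> R) u (e : R) : differentiable f u -> 0 < e ->
  exists2 d : R, 0 < d & forall a b : R, `|a| < d -> `|b| < d ->
    `|f (a + u.1, b + u.2) - f u - (a * dX f u + b * dY f u)| <=
      e * Num.max `|a| `|b|.
Proof.
move=> df e0; have /diff_locallyP[_ /eqaddoP H] := df.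
have /(@nbhs_ballP R (plane R)) [d /= d0 Hd] := H e e0.
exists d => // a b ad bd.
have : ball (0 : plane R) d (a, b) by split; rewrite /ball /= sub0r normrN.
move=> /Hd /=; rewrite !fctE /= diff_plane // prod_normE /= opprD addrA.
by congr (`|f _ - _ - _| <= _).
Qed.

(** The real differential rewritten in terms of h and its conjugate has coefficients f_z and f_zb.
    This is the bridge between derivatives on R * R and derivatives on R[i]; the real and the
    imaginary part each contribute an error of e / 2. *)
Lemma csmooth_expansion U f u (e : R) : csmooth U f -> U u -> 0 < e ->
  exists2 d : R, 0 < d & forall h : R[i], `|h| < d%:C ->
    `|f (ofC (h + toC u)) - f u - (dz f u * h + dzb f u * conjc h)|
       <= e%:C * `|h|.
Proof.
move=> [rf jf] Uu e0; have e20 : 0 < e / 2 by rewrite divr_gt0.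
have [d1 d10 H1] := diff_eps (smooth_diff rf Uu) e20.
have [d2 d20 H2] := diff_eps (smooth_diff jf Uu) e20.
exists (Num.min d1 d2); first by rewrite lt_min d10.
move=> h hd.
have ah : `|complex.Re h| < Num.min d1 d2.
  by rewrite -ltcR; apply: le_lt_trans hd; exact: normc_ge_Re.
have bh : `|complex.Im h| < Num.min d1 d2.
  by rewrite -ltcR; apply: le_lt_trans hd; exact: normc_ge_Im.
have [n E] : exists n : R, `|h| = n%:C by rewrite normc_def; eexists.
have mn : Num.max `|complex.Re h| `|complex.Im h| <= n.
  by rewrite ge_max -!lecR -E normc_ge_Re normc_ge_Im.
move: ah bh; rewrite !lt_min => /andP[a1 a2] /andP[b1 b2].
have {H1}K1 := H1 _ _ a1 b1; have {H2}K2 := H2 _ _ a2 b2.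
rewrite dzE dzbE E.
have -> : ofC (h + toC u) = (complex.Re h + u.1, complex.Im h + u.2).
  by case: (h) => a b; case: (u).
have nn x : x <= e / 2 * Num.max `|complex.Re h| `|complex.Im h| -> x <= e / 2 * n.
  by move=> /le_trans; apply; rewrite ler_wpM2l // ltW.
move: K1 K2 => /nn + /nn.
move: (f (_, _)) (f u) (dX _ u) (dY _ u) (dX _ u) (dY _ u) => F F0 a b c d K1 K2.
apply: le_trans (normc_le_ReIm _) _; rewrite -rmorphM lecR.
rewrite (_ : e * n = e / 2 * n + e / 2 * n); last by rewrite -mulrDl -splitr.
apply: lerD; [move: K1 => {K2}|move: K2 => {K1}]; apply: le_trans;
  case: (h) F F0 {E mn a1 a2 b1 b2 hd nn} => x y [F1 F2] [G1 G2] /=;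
  rewrite le_eqVlt; apply/orP; left; apply/eqP; by congr (`|_|); field.
Qed.

Lemma quotient_sub (h x l : R[i]) : h != 0 -> h^-1 * x - l = h^-1 * (x - l * h).
Proof. by move=> h0; rewrite mulrBr [l * h]mulrC mulKf. Qed.

Lemma derivableC_eps (F : R[i] -> R[i]) (z l : R[i]) :
  (forall e : R, 0 < e -> exists2 d : R, 0 < d &
     forall h : R[i], `|h| < d%:C -> `|F (h + z) - F z - l * h| <= e%:C * `|h|) ->
  derivable (F : R[i]^o -> R[i]^o) z 1 /\
  'D_1 (F : R[i]^o -> R[i]^o) z = l.
Proof.
move=> H.
pose F' : R[i]^o -> R[i]^o := F.
have C : h^-1 *: (F' (h *: (1 : R[i]^o) + z) - F' z) @[h --> (0 : R[i]^o)^'] --> (l : R[i]^o).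
  rewrite /F' {F'}.
  apply: (proj2 (@cvgrPdist_le _ (R[i]^o) _ _ _ _ _)) => eps /complex_gt0P [e e0 ->].
  have [d d0 Hd] := H e e0.
  apply/nbhs_ballP; exists (d%:C); first by rewrite /= ltcR.
  move=> h /=; rewrite -ball_normE /= sub0r normrN => hd h0.
  rewrite /GRing.scale /= mulr1 distrC.
  rewrite quotient_sub //.
  rewrite normrM normfV mulrC ler_pdivrMr ?normr_gt0 //; exact: Hd.
split; first by apply/cvg_ex; exists l.
by rewrite /derive; apply: cvg_lim; [exact: norm_hausdorff|exact: C].
Qed.

Lemma derivableC_expansion (F : R[i] -> R[i]) (z : R[i]) (e : R) :
  derivable (F : R[i]^o -> R[i]^o) z 1 -> 0 < e ->
  exists2 d : R, 0 < d & forall h : R[i], `|h| < d%:C ->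
    `|F (h + z) - F z - 'D_1 (F : R[i]^o -> R[i]^o) z * h| <= e%:C * `|h|.
Proof.
move=> dF e0; have /cvgrPdist_le := dF.
move=> /(_ e%:C); rewrite ltcR => /(_ e0) /nbhs_ballP[_ /= /complex_gt0P[d d0 ->] Hd].
exists d => // h hd; have [->|h0] := eqVneq h 0.
  by rewrite add0r subrr mulr0 subrr !normr0 mulr0.
have hd' : ball (0 : R[i]^o) d%:C h by rewrite -ball_normE /= sub0r normrN.
have : `|'D_1 (F : R[i]^o -> R[i]^o) z - h^-1 * (F (h * 1 + z) - F z)| <= e%:C.
  exact: (Hd h hd' h0).
rewrite mulr1 distrC.
move: ('D_1 (F : R[i]^o -> R[i]^o) z) => l.
rewrite quotient_sub //.
by rewrite normrM normfV mulrC ler_pdivrMr ?normr_gt0.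
Qed.

Lemma ofCK u : ofC (toC u) = u. Proof. by case: u. Qed.

Lemma holomorphic_dzb0 U f : csmooth U f -> (forall u, U u -> dzb f u = 0) ->
  holomorphic_on U f.
Proof.
move=> sf f0 u Uu; apply: (proj1 (@derivableC_eps _ _ (dz f u) _)) => e e0.
have [d d0 H] := csmooth_expansion sf Uu e0; exists d => // h /H.
by rewrite f0 // mul0r addr0 ofCK.
Qed.

(* Comparing the real and the complex first order expansions along the
   increments h and i h separates the coefficients of h and of its conjugate. *)
Lemma holomorphic_dz U f u : csmooth U f -> holomorphic_on U f -> U u ->
  dzb f u = 0 /\ cderiv f u = dz f u.
Proof.
move=> sf hf Uu; rewrite /cderiv; set l := ('D_1 ((fun z => f (ofC z)) : R[i]^o -> R[i]^o) (toC u)).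
have small (a b : R[i]) : (forall e : R, 0 < e ->
    exists2 h : R[i], `|h| != 0 & `|a * h + b * h| <= e%:C * `|h|) -> a + b = 0.
  move=> H; apply/eqP; rewrite -normr_eq0; apply/eqP.
  have [n E] : exists n : R, `|a + b| = n%:C by rewrite normc_def; eexists.
  have n0 : 0 <= n by rewrite -lecR -E normr_ge0.
  rewrite E (_ : n = 0) //; apply: le_anti; rewrite n0 andbT.
  apply/ler_addgt0Pl => e e0; rewrite addr0 -lecR -E.
  have [h h0] := H e e0; rewrite -mulrDl normrM ler_pM2r //.
  by rewrite lt_def h0 normr_ge0.
have two (c : R[i]) : `|c| = 1 -> (dz f u - l) + dzb f u * (conjc c / c) = 0.
  move=> c1; apply: small => e e0; have e20 : 0 < e / 2 by rewrite divr_gt0.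
  have [d1 d10 H1] := csmooth_expansion sf Uu e20.
  have [d2 d20 H2] := derivableC_expansion (hf u Uu) e20.
  pose t := Num.min d1 d2 / 2.
  have m0 : 0 < Num.min d1 d2 by rewrite lt_min d10.
  have t0 : 0 < t by rewrite divr_gt0.
  have tm : t < Num.min d1 d2 by rewrite /t ltr_pdivrMr // ltr_pMr // ltr1n.
  have nh : `|t%:C * c| = t%:C by rewrite normrM c1 mulr1 ger0_norm // lecR ltW.
  move: tm; rewrite lt_min => /andP[td1 td2].
  have K1 := H1 (t%:C * c); have K2 := H2 (t%:C * c).
  rewrite nh ltcR td1 in K1; rewrite nh ltcR td2 in K2.
  have {}K1 := K1 isT; have {}K2 := K2 isT.
  have c0 : c != 0 by rewrite -normr_eq0 c1 oner_eq0.
  exists (t%:C * c); first by rewrite nh; apply: lt0r_neq0; rewrite ltcR.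
  rewrite nh.
  have -> : (dz f u - l) * (t%:C * c) + dzb f u * (conjc c / c) * (t%:C * c) =
     (f (ofC (t%:C * c + toC u)) - f u - l * (t%:C * c)) -
     (f (ofC (t%:C * c + toC u)) - f u - (dz f u * (t%:C * c) + dzb f u * conjc (t%:C * c))).
    have -> : conjc (t%:C * c) = t%:C * conjc c.
      by rewrite rmorphM; congr (_ * _); exact: conjc_real.
    move: (f (ofC (t%:C * c + toC u))) (conjc c) (f u) (dz f u) (dzb f u) => F c' F0 a b.
    move: (t%:C) c0; clear=> s c0; by field.
  apply: le_trans (ler_normB _ _) _.
  rewrite [e in leRHS]splitr rmorphD mulrDl; apply: lerD => //.
  by move: K2; rewrite ofCK.
have E1 := two 1 (normr1 _); rewrite conjc1 divr1 mulr1 in E1.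
have Ei := two 'i%C; rewrite normc_def /= expr0n expr1n /= add0r sqrtr1 in Ei.
have {}Ei := Ei erefl.
have i0 : ('i%C : R[i]) != 0 by rewrite eq_complex /= oner_eq0 andbF.
have ii : conjc ('i%C : R[i]) / 'i%C = -1.
  by apply: (mulIf i0); rewrite divfK //; apply: complexP => /=; ring.
rewrite ii mulrN1 in Ei.
have b0 : dzb f u = 0.
  have dbl (x y : R[i]) : x + y = 0 -> x - y = 0 -> y = 0.
    move=> h1 h2; have : y *+ 2 = (x + y) - (x - y) by ring.
    by rewrite h1 h2 subrr => /eqP; rewrite mulrn_eq0 => /eqP.
  exact: dbl E1 Ei.
by split=> //; move: E1; rewrite b0 addr0 => /eqP; rewrite subr_eq0 => /eqP.
Qed.

Lemma csmooth_comp U V f (g : plane R -> plane R) : open U ->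
  smooth_on U (fun u => (g u).1) -> smooth_on U (fun u => (g u).2) ->
  csmooth V f -> (forall u, U u -> V (g u)) -> csmooth U (fun u => f (g u)).
Proof.
move=> oU g1 g2 [rf jf] UV.
have UV' u : U u -> V ((g u).1, (g u).2) by move/UV; case: (g u).
split.
  apply: (@smooth_ext _ _ (fun u => complex.Re (f ((g u).1, (g u).2)))) => //.
    by move=> u _; case: (g u).
  by move=> k; exact: (Ck_comp oU (g1 k) (g2 k) (rf k) UV').
apply: (@smooth_ext _ _ (fun u => complex.Im (f ((g u).1, (g u).2)))) => //.
  by move=> u _; case: (g u).
by move=> k; exact: (Ck_comp oU (g1 k) (g2 k) (jf k) UV').
Qed.

Lemma derive_comp_map (f : plane R -> R) (g : plane R -> plane R) u v :
  differentiable (fun u => (g u).1) u -> differentiable (fun u => (g u).2) u ->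
  differentiable f (g u) ->
  'D_v (fun x => f (g x)) u =
    'D_v (fun x => (g x).1) u * dX f (g u) + 'D_v (fun x => (g x).2) u * dY f (g u).
Proof.
move=> d1 d2 df.
have e : (fun x => f (g x)) = (fun x => f ((g x).1, (g x).2)).
  by apply/funext => x; case: (g x).
by rewrite e derive_comp_plane //; case: (g u) df.
Qed.

(** In the general chain rule the other two terms carry the factor g_zb or its conjugate, so they
    vanish for an inner map satisfying the Cauchy-Riemann equation. *)
Lemma dz_comp U V f (g : plane R -> plane R) u : open U ->
  smooth_on U (fun u => (g u).1) -> smooth_on U (fun u => (g u).2) ->
  csmooth V f -> (forall u, U u -> V (g u)) -> U u ->
  dzb (fun v => toC (g v)) u = 0 ->
  dz (fun v => f (g v)) u = dz f (g u) * dz (fun v => toC (g v)) u /\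
  dzb (fun v => f (g v)) u = dzb f (g u) * conjc (dz (fun v => toC (g v)) u).
Proof.
move=> oU g1 g2 [rf jf] UV Uu.
have d1 := smooth_diff g1 Uu; have d2 := smooth_diff g2 Uu.
have drf := smooth_diff rf (UV _ Uu); have djf := smooth_diff jf (UV _ Uu).
have Hr v := derive_comp_map v d1 d2 drf.
have Hi v := derive_comp_map v d1 d2 djf.
have X (h : plane R -> R) : dX h u = 'D_(1, 0) h u by [].
have Y (h : plane R -> R) : dY h u = 'D_(0, 1) h u by [].
rewrite !dzE !dzbE /= !(X (fun v => complex.Re (f (g v)))) !(Y (fun v => complex.Re (f (g v)))).
rewrite !(X (fun v => complex.Im (f (g v)))) !(Y (fun v => complex.Im (f (g v)))) !Hr !Hi -!X -!Y.
move: (dX _ u) (dY _ u) (dX _ u) (dY _ u) (dX _ (g u)) (dY _ (g u)) (dX _ (g u)) (dY _ (g u)).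
clear=> a b c d p q r s [/eqP E1 /eqP E2].
move: E1 E2; rewrite !mulf_eq0 !invr_eq0 !pnatr_eq0 !orbF subr_eq0 addr_eq0.
by move=> /eqP -> /eqP ->; split; apply: complexP => /=; field.
Qed.

(** Under the Cauchy-Riemann equation the Jacobian is the squared modulus of g_z. *)
Lemma jacobian_holomorphic (g : plane R -> plane R) u :
  dzb (fun v => toC (g v)) u = 0 -> 0 < Defs.jacobian g u ->
  dz (fun v => toC (g v)) u != 0.
Proof.
rewrite dzE dzbE /Defs.jacobian /=.
move: (dX _ u) (dY _ u) (dX _ u) (dY _ u) => a b c d [/eqP E1 /eqP E2].
move: E1 E2; rewrite !mulf_eq0 !invr_eq0 !pnatr_eq0 !orbF subr_eq0 addr_eq0.
move=> /eqP -> /eqP -> J; apply/eqP => -[/eqP E1 /eqP E2]; move: E1 E2 J.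
rewrite !mulf_eq0 !invr_eq0 !pnatr_eq0 !orbF.
rewrite -mulr2n -opprD oppr_eq0 -mulr2n !mulrn_eq0 /= => /eqP -> /eqP ->.
by rewrite !oppr0 !mulr0 subrr ltxx.
Qed.

End ComplexDerivative.

(** * Vector-valued functions and the complexified bilinear form *)

Section VectorCalculus.
Context {R : realType} {n : nat}.
Implicit Types (U : set (plane R)) (F K : plane R -> 'rV[R[i]]_n).
Implicit Types (G : 'M[R]_n) (x y : 'rV[R[i]]_n) (u : plane R).

Definition vsmooth U F := forall j, csmooth U (fun v => F v 0 j).
Definition vdzb F u : 'rV[R[i]]_n := \row_j dzb (fun v => F v 0 j) u.

Lemma vsmooth_ext U F K : open U -> (forall u, U u -> F u = K u) ->
  vsmooth U F -> vsmooth U K.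
Proof. by move=> oU FK sF j; apply: csmooth_ext oU _ (sF j) => u /FK ->. Qed.

Lemma vdz_ext U F K u : open U -> (forall v, U v -> F v = K v) -> U u ->
  vdz F u = vdz K u.
Proof.
move=> oU FK Uu; apply/rowP => j; rewrite !mxE.
by apply: (dz_ext oU) Uu => v /FK ->.
Qed.

Lemma vdzb_ext U F K u : open U -> (forall v, U v -> F v = K v) -> U u ->
  vdzb F u = vdzb K u.
Proof.
move=> oU FK Uu; apply/rowP => j; rewrite !mxE.
by apply: (dzb_ext oU) Uu => v /FK ->.
Qed.

Lemma vsmooth_vdz U F : open U -> vsmooth U F -> vsmooth U (vdz F).
Proof.
by move=> oU sF j; apply: csmooth_ext oU _ (csmooth_dz oU (sF j)) => u _; rewrite mxE.
Qed.

Lemma vsmooth_conj U F : open U -> vsmooth U F -> vsmooth U (fun v => conjv (F v)).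
Proof.
by move=> oU sF j; apply: csmooth_ext oU _ (csmooth_conj oU (sF j)) => u _; rewrite mxE.
Qed.

Lemma vsmoothB U F K : open U -> vsmooth U F -> vsmooth U K ->
  vsmooth U (fun v => F v - K v).
Proof.
by move=> oU sF sK j; apply: csmooth_ext oU _ (csmoothB oU (sF j) (sK j)) => u _; rewrite !mxE.
Qed.

Lemma vsmoothZ U (a : plane R -> R[i]) F : open U -> csmooth U a -> vsmooth U F ->
  vsmooth U (fun v => a v *: F v).
Proof.
by move=> oU sa sF j; apply: csmooth_ext oU _ (csmoothM oU sa (sF j)) => u _; rewrite mxE.
Qed.

Lemma vdzZ U (a : plane R -> R[i]) F u : open U -> csmooth U a -> vsmooth U F ->
  U u -> vdz (fun v => a v *: F v) u = dz a u *: F u + a u *: vdz F u.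
Proof.
move=> oU sa sF Uu; apply/rowP => j; rewrite !mxE -(dzM oU sa (sF j) Uu).
by apply: (dz_ext oU) Uu => v _; rewrite mxE.
Qed.

Lemma vdzbZ U (a : plane R -> R[i]) F u : open U -> csmooth U a -> vsmooth U F ->
  U u -> vdzb (fun v => a v *: F v) u = dzb a u *: F u + a u *: vdzb F u.
Proof.
move=> oU sa sF Uu; apply/rowP => j; rewrite !mxE -(dzbM oU sa (sF j) Uu).
by apply: (dzb_ext oU) Uu => v _; rewrite mxE.
Qed.

Lemma dzbN U (f : plane R -> R[i]) u : open U -> csmooth U f -> U u ->
  dzb (fun v => - f v) u = - dzb f u.
Proof.
move=> oU sf Uu; rewrite -[RHS]mulN1r -[RHS]add0r -[X in X + _](mul0r (f u)).
rewrite -[X in X * f u](dzb_cst (-1) u) -(dzbM oU _ sf Uu); last exact: csmooth_cst.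
by apply: (dzb_ext oU) Uu => v _; rewrite mulN1r.
Qed.

Lemma vdzbB U F K u : open U -> vsmooth U F -> vsmooth U K -> U u ->
  vdzb (fun v => F v - K v) u = vdzb F u - vdzb K u.
Proof.
move=> oU sF sK Uu; apply/rowP => j; rewrite !mxE -(dzbN oU (sK j) Uu).
rewrite -(dzbD oU (sF j) (csmoothN oU (sK j)) Uu).
by apply: (dzb_ext oU) Uu => v _; rewrite !mxE.
Qed.

Lemma conjvK : involutive (@conjv R n).
Proof. by move=> x; apply/rowP => j; rewrite !mxE conjcK. Qed.

Lemma conjvD x y : conjv (x + y) = conjv x + conjv y.
Proof. by apply/rowP => j; rewrite !mxE rmorphD. Qed.

Lemma conjvZ (a : R[i]) x : conjv (a *: x) = conjc a *: conjv x.
Proof. by apply/rowP => j; rewrite !mxE rmorphM. Qed.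

Lemma conjv_complexify (x : 'rV[R]_n) : conjv (complexify x) = complexify x.
Proof. by apply/rowP => j; rewrite !mxE; exact: conjc_real. Qed.

Lemma vdz_conj U F u : vsmooth U F -> U u ->
  vdz (fun v => conjv (F v)) u = conjv (vdzb F u).
Proof.
move=> sF Uu; apply/rowP => j; rewrite !mxE -dz_conj; last by exists U.
by congr (dz _ u); apply/funext => v; rewrite mxE.
Qed.

Lemma vdzb_conj U F u : open U -> vsmooth U F -> U u ->
  vdzb (fun v => conjv (F v)) u = conjv (vdz F u).
Proof.
move=> oU sF Uu; apply/rowP => j; rewrite !mxE -(dzb_conj oU (sF j) Uu).
by congr (dzb _ u); apply/funext => v; rewrite mxE.
Qed.

Lemma vdz_vdzb U F u : open U -> vsmooth U F -> U u ->
  vdz (vdzb F) u = vdzb (vdz F) u.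
Proof.
move=> oU sF Uu; apply/rowP => j; rewrite !mxE.
have -> : (fun v => vdzb F v 0 j) = dzb (fun v => F v 0 j).
  by apply/funext => v; rewrite mxE.
have -> : (fun v => vdz F v 0 j) = dz (fun v => F v 0 j).
  by apply/funext => v; rewrite mxE.
exact: dz_dzb oU (sF j) Uu.
Qed.

Lemma cformE G x y :
  cform G x y = \sum_k \sum_j (x 0 j * (G j k)%:C * y 0 k).
Proof.
rewrite /cform /bform mxE; apply: eq_bigr => k _; rewrite !mxE mulr_suml.
by apply: eq_bigr => j _; rewrite !mxE.
Qed.

Lemma cformDl G x1 x2 y : cform G (x1 + x2) y = cform G x1 y + cform G x2 y.
Proof. by rewrite /cform /bform !mulmxDl mxE. Qed.

Lemma cformDr G x y1 y2 : cform G x (y1 + y2) = cform G x y1 + cform G x y2.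
Proof. by rewrite /cform /bform linearD mulmxDr mxE. Qed.

Lemma cformZl G (a : R[i]) x y : cform G (a *: x) y = a * cform G x y.
Proof. by rewrite /cform /bform -!scalemxAl mxE. Qed.

Lemma cformZr G (a : R[i]) x y : cform G x (a *: y) = a * cform G x y.
Proof. by rewrite /cform /bform linearZ -scalemxAr mxE. Qed.

Lemma cformBl G x1 x2 y : cform G (x1 - x2) y = cform G x1 y - cform G x2 y.
Proof. by rewrite cformDl -scaleN1r cformZl mulN1r. Qed.

Lemma bform_sym (K : comNzRingType) (m : nat) (M : 'M[K]_m) (x y : 'rV[K]_m) :
  M^T = M -> bform M x y = bform M y x.
Proof.
move=> Ms; have -> : bform M x y = (x *m M *m y^T)^T 0 0 by rewrite [RHS]mxE.
by rewrite !trmx_mul trmxK Ms mulmxA.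
Qed.

Lemma cform_sym G x y : G^T = G -> cform G x y = cform G y x.
Proof. by move=> Gs; apply: bform_sym; rewrite /complexify map_trmx Gs. Qed.

Lemma cform_conj G x y : conjc (cform G x y) = cform G (conjv x) (conjv y).
Proof.
rewrite !cformE rmorph_sum; apply: eq_bigr => k _; rewrite rmorph_sum.
apply: eq_bigr => j _; rewrite !rmorphM !mxE; congr (_ * _ * _).
exact: conjc_real.
Qed.

Lemma cform_complexify G (x y : 'rV[R]_n) :
  cform G (complexify x) (complexify y) = (bform G x y)%:C.
Proof.
rewrite /cform /bform /complexify map_trmx -!map_mxM /=.
by rewrite mxE.
Qed.

Lemma csmooth_dz_cform U G F K u : open U -> vsmooth U F -> vsmooth U K -> U u ->
  csmooth U (fun v => cform G (F v) (K v)) /\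
  dz (fun v => cform G (F v) (K v)) u =
    cform G (vdz F u) (K u) + cform G (F u) (vdz K u).
Proof.
move=> oU sF sK Uu.
have -> : (fun v => cform G (F v) (K v)) =
    (fun v => \sum_k \sum_j (F v 0 j * (G j k)%:C * K v 0 k)).
  by apply/funext => v; exact: cformE.
have s1 k j : csmooth U (fun v => F v 0 j * (G j k)%:C).
  by apply: csmoothM => //; exact: csmooth_cst.
have s2 k j : csmooth U (fun v => F v 0 j * (G j k)%:C * K v 0 k).
  exact: csmoothM oU (s1 k j) (sK k).
have S1 k := dz_sum oU (s2 k) Uu.
have [S2 ->] := dz_sum oU (fun k => (S1 k).1) Uu; split => //.
rewrite !cformE -big_split; apply: eq_bigr => k _ /=.
rewrite (S1 k).2 -big_split; apply: eq_bigr => j _ /=.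
rewrite (dzM oU (s1 k j) (sK k) Uu) (dzM oU (sF j) (csmooth_cst _ _) Uu) dz_cst.
by rewrite mulr0 addr0 !mxE.
Qed.

Lemma csmooth_cform U G F K : open U -> vsmooth U F -> vsmooth U K ->
  csmooth U (fun v => cform G (F v) (K v)).
Proof.
(* The combined statement asks for a point of U; if there is none, smoothness on U holds
   vacuously. *)
move=> oU sF sK; have [[u Uu]|U0] := pselect (exists u, U u).
  exact: (csmooth_dz_cform G oU sF sK Uu).1.
by split=> k; apply: Ck_pointwise => u Uu; case: U0; exists u.
Qed.

Lemma dz_cform U G F K u : open U -> vsmooth U F -> vsmooth U K -> U u ->
  dz (fun v => cform G (F v) (K v)) u =
    cform G (vdz F u) (K u) + cform G (F u) (vdz K u).
Proof. by move=> oU sF sK Uu; have [] := csmooth_dz_cform G oU sF sK Uu. Qed.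

Lemma dzb_cform U G F K u : open U -> vsmooth U F -> vsmooth U K -> U u ->
  dzb (fun v => cform G (F v) (K v)) u =
    cform G (vdzb F u) (K u) + cform G (F u) (vdzb K u).
Proof.
move=> oU sF sK Uu; rewrite dzbN_conj; last by exists U => //; exact: csmooth_cform.
have -> : (fun v => conjc (cform G (F v) (K v))) =
    (fun v => cform G (conjv (F v)) (conjv (K v))).
  by apply/funext => v; exact: cform_conj.
rewrite (dz_cform G oU (vsmooth_conj oU sF) (vsmooth_conj oU sK) Uu).
rewrite (vdz_conj sF Uu) (vdz_conj sK Uu) rmorphD /=.
by congr (_ + _); rewrite cform_conj !conjvK.
Qed.

Lemma dz_eq0 U (f : plane R -> R[i]) (c : R[i]) u : open U ->
  (forall v, U v -> f v = c) -> U u -> dz f u = 0.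
Proof. by move=> oU f0 Uu; rewrite -(dz_cst c u); exact: dz_ext oU f0 Uu. Qed.

Lemma dzb_eq0 U (f : plane R -> R[i]) (c : R[i]) u : open U ->
  (forall v, U v -> f v = c) -> U u -> dzb f u = 0.
Proof. by move=> oU f0 Uu; rewrite -(dzb_cst c u); exact: dzb_ext oU f0 Uu. Qed.

End VectorCalculus.

(** * The harmonic sequence *)

Section HarmonicSequence.
Context {R : realType} {n : nat} (G : 'M[R]_n) (U : set (plane R)).
Context (F : plane R -> 'rV[R[i]]_n) (h0 : R) (r : nat) (mu : plane R -> R[i]).
Hypothesis (Gs : G^T = G) (oU : open U) (sF : vsmooth U F).
Hypothesis F_real : forall u, conjv (F u) = F u.
Hypothesis h0_neq0 : h0 != 0.
Hypothesis FF : forall u, U u -> cform G (F u) (F u) = h0%:C.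

Local Notation ph := (harmonic_seq G F).
Let H i u := cform G (ph i u) (conjv (ph i u)).

Hypothesis iso : forall i, (1 <= i <= r)%N -> forall u, U u ->
  H i u != 0 /\ cform G (ph i u) (ph i u) = 0.
Hypothesis harm : forall u, U u -> vdzb (vdz F) u = mu u *: F u.

(** The value 0 at i = 0 reflects that phi_1 is phi_z with no correction term; with it, the
    recursion [hs_succ] has the same shape for all i. *)
Definition hs_coeff i u : R[i] :=
  if i is 0 then 0 else cform G (vdz (ph i) u) (conjv (ph i u)) / H i u.
Local Notation a := hs_coeff.

Lemma hs_H0 u : U u -> H 0 u = h0%:C.
Proof. by move=> Uu; rewrite /H /= F_real FF. Qed.

Lemma hs_H_neq0 i u : (i <= r)%N -> U u -> H i u != 0.
Proof.
case: i => [|i] ir Uu; last by have [] := iso (i := i.+1) ir Uu.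
by rewrite hs_H0 // eq_complex /= eqxx andbT.
Qed.

Lemma hs_succ i u : ph i.+1 u = vdz (ph i) u - a i u *: ph i u.
Proof. by case: i => [|i] //; rewrite /a scale0r subr0. Qed.

Lemma hs_vdz i u : vdz (ph i) u = ph i.+1 u + a i u *: ph i u.
Proof. by rewrite hs_succ subrK. Qed.

Lemma hs_smooth_coeff i : (i <= r)%N -> vsmooth U (ph i) -> csmooth U (a i).
Proof.
case: i => [|i] ir sp; first exact: csmooth_cst.
apply: csmoothM => //.
  by apply: csmooth_cform => //; [exact: vsmooth_vdz|exact: vsmooth_conj].
apply: csmoothV => //; first by move=> u Uu; exact: (hs_H_neq0 (i := i.+1)).
by apply: csmooth_cform => //; exact: vsmooth_conj.
Qed.

Lemma hs_smooth i : (i <= r.+1)%N -> vsmooth U (ph i).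
Proof.
elim: i => [|i IH] ir //; have sp := IH (ltnW ir).
apply: (@vsmooth_ext _ _ U (fun u => vdz (ph i) u - a i u *: ph i u)) => //.
  by move=> u _; rewrite -hs_succ.
apply: vsmoothB => //; first exact: vsmooth_vdz.
by apply: vsmoothZ => //; exact: hs_smooth_coeff.
Qed.

Lemma hs_smooth_H i : (i <= r.+1)%N -> csmooth U (H i).
Proof.
by move=> ir; apply: csmooth_cform => //; [|apply: vsmooth_conj => //]; exact: hs_smooth.
Qed.

Lemma hs_smooth_a i : (i <= r)%N -> csmooth U (a i).
Proof. by move=> ir; apply: hs_smooth_coeff => //; apply: hs_smooth; exact: leqW. Qed.

Lemma hs_dz_B i j u : (i <= r)%N -> (j <= r)%N -> U u ->
  dz (fun v => cform G (ph i v) (ph j v)) u =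
    cform G (ph i.+1 u) (ph j u) + cform G (ph i u) (ph j.+1 u)
    + (a i u + a j u) * cform G (ph i u) (ph j u).
Proof.
move=> ir jr Uu; rewrite (dz_cform G oU (hs_smooth (leqW ir)) (hs_smooth (leqW jr)) Uu).
rewrite !hs_vdz cformDl cformDr cformZl cformZr mulrDl.
by rewrite addrACA.
Qed.

(* Induction on i + j, then on j - i: differentiating <phi_i, phi_{j-1}> = 0
   moves the pair (i, j) one step closer to the diagonal. *)
Lemma hs_B_eq0 i j u : (i <= r.+1)%N -> (j <= r.+1)%N -> (0 < i + j <= r + r.+1)%N ->
  U u -> cform G (ph i u) (ph j u) = 0.
Proof.
suff K s : forall d i j, (i <= j)%N -> (j - i)%N = d -> (i + j)%N = s -> (j <= r.+1)%N ->
    (0 < s <= r + r.+1)%N -> forall u, U u -> cform G (ph i u) (ph j u) = 0.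
  move=> ir jr ij Uu; case: (leqP i j) => le.
    exact: (K (i + j)%N (j - i)%N).
  rewrite cform_sym //; apply: (K (i + j)%N (i - j)%N) => //; last by rewrite addnC.
  exact: ltnW.
elim/ltn_ind: s => s IHs d; elim/ltn_ind: d => d IHd {}i {}j ij dij sij jr s0 {}u Uu.
have [|ltij] := leqP j i.
  move=> ji; have e : i = j by apply/eqP; rewrite eqn_leq ij.
  subst j; apply: (iso (i := i) _ Uu).2; lia.
case: j ij dij sij jr ltij => [//|j] ij dij sij jr ltij.
have jr' : (j <= r)%N by [].
have ir' : (i <= r)%N by apply: leq_trans jr'; rewrite -ltnS.
have D := hs_dz_B ir' jr' Uu.
(* For neighbours (i, i+1) the two terms of the derivative of <phi_i, phi_i> coincide by symmetry,
   so each vanishes. When i = 0 the differentiated function is the constant h0 instead of 0. *)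
have [eij|neij] := eqVneq i j.
  subst i; case: j s0 sij ir' jr' D {ij dij jr ltij} => [|j] s0 sij ir' jr' D.
    move: D; rewrite (dz_eq0 oU (c := h0%:C) _ Uu); last by move=> v Uv; exact: FF.
    rewrite (cform_sym _ _ Gs) addr0 mul0r addr0 -mulr2n => /esym/eqP.
    by rewrite mulrn_eq0 /= => /eqP.
  have Z v : U v -> cform G (ph j.+1 v) (ph j.+1 v) = 0 by move=> Uv; exact: (iso (i := j.+1) ir' Uv).2.
  move: D; rewrite (dz_eq0 oU Z Uu) Z // mulr0 addr0.
  rewrite (cform_sym _ _ Gs) -mulr2n => /esym/eqP.
  by rewrite mulrn_eq0 /= => /eqP.
have lij : (i < j)%N by lia.
have Z v : U v -> cform G (ph i v) (ph j v) = 0.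
  move=> Uv; apply: (IHs (i + j)%N _ (j - i)%N) => //; lia.
move: D; rewrite (dz_eq0 oU Z Uu) Z // mulr0 addr0.
rewrite (IHd (j - i.+1)%N _ i.+1 j) //; try lia.
by rewrite add0r.
Qed.

Let HH i j u := cform G (ph i u) (conjv (ph j u)).

Lemma hs_HHC i j u : HH i j u = 0 -> HH j i u = 0.
Proof.
move=> E; rewrite /HH cform_sym // -[ph j u]conjvK -cform_conj.
by rewrite -/(HH i j u) E conjc0.
Qed.

Lemma hs_vdzb_conj0 u : U u -> vdzb F u = conjv (ph 1 u).
Proof.
move=> Uu /=; rewrite -(vdzb_conj oU sF Uu); congr (vdzb _ u).
by apply/funext => v; rewrite F_real.
Qed.

(** In (h_i)_z the term where the conjugate factor is differentiated is a multiple of <phi_i, conj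
    phi_{i-1}> = 0, and the other term is a_i h_i by definition of a_i. The two facts used are
    hypotheses here because the lemma serves inside the induction that proves them. *)
Lemma hs_dz_H_gen i u : (i <= r)%N -> U u ->
  (if i is i'.+1 then vdzb (ph i) u = - (H i u / H i' u) *: ph i' u /\ HH i i' u = 0
   else True) -> dz (H i) u = a i u * H i u.
Proof.
case: i => [|i] ir Uu.
  by move=> _; rewrite /a mul0r (dz_eq0 oU (c := h0%:C)) // => v; exact: hs_H0.
move=> [E Z]; have s := hs_smooth (leqW ir).
rewrite /H (dz_cform G oU s (vsmooth_conj oU s) Uu).
rewrite (vdz_conj s Uu) E conjvZ cformZr -/(HH i.+1 i u) Z mulr0 addr0.
by rewrite /a divfK //; exact: (hs_H_neq0 (i := i.+1)).
Qed.

(** The three predicates are proved by one induction: [orth] up to k and [recb] up to k - 1 give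
    both [orth] up to k + 1 and the relations of [recb] and [toda] at k. They quantify over all of U
    because the relations get differentiated. *)
Let orth k := forall i j, (i < j)%N -> (j <= k)%N -> forall u, U u -> HH j i u = 0.
Let recb k := forall i, (i <= k)%N -> forall u, U u ->
  vdzb (ph i.+1) u = - (H i.+1 u / H i u) *: ph i u.
Let toda k := forall i, (1 <= i <= k)%N -> forall u, U u ->
  dzb (a i) u = H i.+1 u / H i u - H i u / H i.-1 u.

Lemma hs_HH_succ k i u : (k <= r)%N -> (i < k)%N -> U u -> HH k i u = 0 ->
  HH k.+1 i u = cform G (vdz (ph k) u) (conjv (ph i u)).
Proof.
by move=> kr ik Uu Z; rewrite /HH hs_succ cformBl cformZl -/(HH k i u) Z mulr0 subr0.
Qed.

(** Subtracting a_k phi_k is the Gram-Schmidt projection away from phi_k. For k = 0 nothing is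
    subtracted; since phi_0 is real, the claim is then the bilinear relation <phi_1, phi_0> = 0. *)
Lemma hs_HH_diag k u : (k <= r)%N -> U u -> HH k.+1 k u = 0.
Proof.
case: k => [|k] kr Uu; first by rewrite /HH /= F_real; apply: (hs_B_eq0 (i := 1) (j := 0)); lia || done.
rewrite /HH hs_succ cformBl cformZl /a divfK ?subrr //.
exact: (hs_H_neq0 (i := k.+1)).
Qed.

(** For i < k, differentiating <phi_k, conj phi_i> = 0 leaves <phi_k, conj((phi_i)_zb)> to be
    killed. For i >= 1 it is a multiple of <phi_k, conj phi_{i-1}>; for i = 0 it equals <phi_k,
    phi_1> because phi_0 is real, and there isotropy is what makes it vanish. *)
Lemma hs_orth_step k : (1 <= k <= r)%N -> orth k -> recb k.-1 -> orth k.+1.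
Proof.
case: k => // k kr O E i j ij; rewrite leq_eqVlt => /predU1P[ej|]; last by move=> jk; exact: O.
subst j; move=> u Uu.
have kr' : (k.+1 <= r)%N by [].
move: ij; rewrite ltnS leq_eqVlt => /predU1P[->|ik]; first exact: hs_HH_diag.
rewrite hs_HH_succ //; last exact: O.
have sk := hs_smooth (leqW kr'); have si : vsmooth U (ph i) by apply: hs_smooth; lia.
have D := dz_cform G oU sk (vsmooth_conj oU si) Uu.
have Z0 v : U v -> cform G (ph k.+1 v) (conjv (ph i v)) = 0 by move=> Uv; exact: O.
rewrite (dz_eq0 oU Z0 Uu) in D.
rewrite (vdz_conj si Uu) in D.
suff Z : cform G (ph k.+1 u) (conjv (vdzb (ph i) u)) = 0 by rewrite Z addr0 in D.
case: i ik {si D Z0} => [|i] ik.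
  by rewrite hs_vdzb_conj0 // conjvK; apply: hs_B_eq0 => //; lia.
rewrite E //; last by rewrite /=; lia.
by rewrite conjvZ cformZr -/(HH k.+1 i u) (O i) ?mulr0 //; lia.
Qed.

Lemma hs_dz_H_of i u : (i <= r)%N -> orth i -> recb i.-1 -> U u ->
  dz (H i) u = a i u * H i u.
Proof.
by case: i => [|i] ir O E Uu; apply: hs_dz_H_gen => //; split; [apply: E|apply: O].
Qed.

(** Commuting the two derivatives shows that (phi_{k+1})_zb is a multiple of phi_k, with a factor
    involving (a_k)_zb. Orthogonality of phi_{k+1} and phi_k then evaluates that factor, which gives
    the recursion and the Toda relation at the same time. *)
Lemma hs_recb_step k : (1 <= k <= r)%N -> orth k -> recb k.-1 ->
  (forall u, U u -> vdzb (ph k.+1) u = - (H k.+1 u / H k u) *: ph k u /\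
     dzb (a k) u = H k.+1 u / H k u - H k u / H k.-1 u).
Proof.
case: k => // k kr O E u Uu; rewrite [k.+1.-1]/= in E *.
have kr' : (k.+1 <= r)%N by [].
have kr2 : (k <= r)%N by exact: ltnW.
have sk := hs_smooth (leqW kr'); have sk1 : vsmooth U (ph k.+2) by exact: hs_smooth.
have sk0 := hs_smooth (leqW kr2).
have sa := hs_smooth_a kr'.
have n0 v : U v -> H k v != 0 by move=> Uv; exact: hs_H_neq0.
have n1 : H k.+1 u != 0 by exact: hs_H_neq0.
have dk : dz (H k.+1) u = a k.+1 u * H k.+1 u by apply: hs_dz_H_of.
have dk0 : dz (H k) u = a k u * H k u.
  apply: hs_dz_H_of => //.
    by move=> i j ij jk; apply: O => //; exact: leqW.
  by move=> i ik; apply: E; lia.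
pose c v := H k.+1 v / H k v.
have sc : csmooth U c.
  apply: csmoothM => //; first by apply: hs_smooth_H; exact: leqW.
  by apply: csmoothV => //; apply: hs_smooth_H; exact: leqW.
have sNc : csmooth U (fun v => - c v) by exact: csmoothN.
have dc : dz (fun v => - c v) u = - (c u * (a k.+1 u - a k u)).
  have e : dz (fun v => - c v) u = dz (fun v => (- 1) * c v) u.
    by apply: (dz_ext oU) Uu => v _; rewrite mulN1r.
  rewrite e (dzM oU (csmooth_cst _ _) sc Uu) dz_cst mul0r add0r.
  have sV : csmooth U (fun v => (H k v)^-1).
    by apply: csmoothV => //; apply: hs_smooth_H; exact: leqW.
  rewrite (dzM oU (hs_smooth_H (leqW kr')) sV Uu) dk.
  rewrite (dzV oU n0 (hs_smooth_H (leqW kr2)) Uu) dk0.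
  rewrite /c; move: (n0 _ Uu); move: (H k u) (H k.+1 u) (a k u) (a k.+1 u).
  by move=> x y z t x0; field.
(* The terms along [ph k] cancel: by [dc], the logarithmic derivative of [c] is the difference of
   the two coefficients a. *)
have main : vdzb (ph k.+2) u = - (c u + dzb (a k.+1) u) *: ph k.+1 u.
  have e : vdzb (ph k.+2) u = vdzb (fun v => vdz (ph k.+1) v - a k.+1 v *: ph k.+1 v) u.
    by apply: (vdzb_ext oU) Uu => v _; exact: hs_succ.
  rewrite e (vdzbB oU (vsmooth_vdz oU sk) (vsmoothZ oU sa sk) Uu).
  rewrite (vdzbZ oU sa sk Uu) -(vdz_vdzb oU sk Uu).
  have -> : vdz (vdzb (ph k.+1)) u = vdz (fun v => - c v *: ph k v) u.
    by apply: (vdz_ext oU) Uu => v Uv; rewrite E.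
  rewrite (vdzZ oU sNc sk0 Uu) dc hs_vdz E // -/(c u).
  move: (ph k u) (ph k.+1 u) (c u) (a k u) (a k.+1 u) (dzb (a k.+1) u).
  move=> x y s t w z; apply/rowP => j; rewrite !mxE.
  by move: (x _ _) (y _ _) => p q; ring.
(* The zb-derivative of <phi_{k+2}, conj phi_{k+1}> = 0 compares the unknown factor times h_{k+1}
   with h_{k+2}. *)
have key : c u + dzb (a k.+1) u = H k.+2 u / H k.+1 u.
  have D := dzb_cform G oU sk1 (vsmooth_conj oU sk) Uu.
  have Z0 v : U v -> cform G (ph k.+2 v) (conjv (ph k.+1 v)) = 0.
    by move=> Uv; exact: hs_HH_diag.
  rewrite (dzb_eq0 oU Z0 Uu) main cformZl -/(H k.+1 u) (vdzb_conj oU sk Uu) in D.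
  rewrite hs_vdz conjvD conjvZ cformDr cformZr Z0 // mulr0 addr0 -/(H k.+2 u) in D.
  apply: (mulIf n1); rewrite divfK //; apply/eqP; rewrite -subr_eq0.
  by rewrite -oppr_eq0 opprB addrC -mulNr -D.
split; first by rewrite main key.
by rewrite -key [c u + _]addrC addrK.
Qed.

Lemma hs_main k : (k <= r)%N -> [/\ orth k.+1, recb k & toda k].
Proof.
elim: k => [|k IH] kr.
  split.
  - by case=> [|i] [|[|j]] // _ _ u Uu; exact: (hs_HH_diag (k := 0)).
  (* The zb-derivative of <phi_1, phi_0> = 0 determines the factor given by harmonicity: mu = - h_1
     / h_0. *)
  - case=> // _ u Uu; rewrite (hs_H0 Uu) /=.
    have D := dzb_cform G oU (vsmooth_vdz oU sF) sF Uu.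
    have Z v : U v -> cform G (vdz F v) (F v) = 0.
      by move=> Uv; apply: (hs_B_eq0 (i := 1) (j := 0)) => //; lia.
    rewrite (dzb_eq0 oU Z Uu) harm // cformZl FF // hs_vdzb_conj0 // -/(H 1 u) in D.
    rewrite harm //; congr (_ *: _).
    have n0 : (h0%:C : R[i]) != 0 by rewrite eq_complex /= eqxx andbT.
    apply: (mulIf n0); rewrite mulNr divfK //.
    by apply/eqP; rewrite -addr_eq0 -D.
  - by case.
have [Or E IHT] := IH (ltnW kr).
have S := hs_recb_step (k := k.+1) kr Or E.
split.
- exact: (hs_orth_step (k := k.+1) kr Or E).
- move=> i; rewrite leq_eqVlt => /predU1P[-> u Uu|ik]; first by have [] := S u Uu.
  exact: E.
- move=> i /andP[i1]; rewrite leq_eqVlt => /predU1P[-> u Uu|ik]; first by have [] := S u Uu.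
  by apply: IHT; rewrite i1.
Qed.

Lemma hs_HH_eq0 i j u : (i <= r.+1)%N -> (j <= r.+1)%N -> i != j -> U u ->
  cform G (ph i u) (conjv (ph j u)) = 0.
Proof.
move=> ir jr; have [Or _ _] := hs_main (leqnn r).
rewrite neq_ltn => /orP[] ij Uu; last exact: Or.
by apply: hs_HHC; exact: Or.
Qed.

Lemma hs_vdzb i u : (i <= r)%N -> U u -> vdzb (ph i.+1) u = - (H i.+1 u / H i u) *: ph i u.
Proof. by move=> ir; have [_ E _] := hs_main ir; apply: E. Qed.

Lemma hs_toda i u : (1 <= i <= r)%N -> U u ->
  dzb (a i) u = H i.+1 u / H i u - H i u / H i.-1 u.
Proof. by move=> /andP[i1 ir]; have [_ _ E] := hs_main ir; apply: E; rewrite i1 /=. Qed.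

Lemma hs_dz_H i u : (i <= r)%N -> U u -> dz (H i) u = a i u * H i u.
Proof.
move=> ir; have [Or E _] := hs_main ir; apply: hs_dz_H_of => //.
  by move=> s t st ti; apply: Or => //; exact: leqW.
by move=> s si; apply: E; lia.
Qed.

End HarmonicSequence.

(** * The unit normal of an isotropic frame *)

Section CrossProduct.
Context {K : fieldType} {m : nat}.
Implicit Types (V : 'M[K]_(m, m + 1)) (w : 'rV[K]_(m + 1)).

Definition cross V : 'rV[K]_(m + 1) := \row_j \det (col_mx V (delta_mx 0 j)).

(** Expansion along the last row, whose cofactors do not depend on that row ([C0]). *)
Lemma det_col_mx_cross V w : \det (col_mx V w) = (w *m (cross V)^T) 0 0.
Proof.
pose i0 : 'I_(m + 1) := rshift m ord0.
have C0 w1 w2 j : cofactor (col_mx V w1) i0 j = cofactor (col_mx V w2) i0 j.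
  rewrite /cofactor; congr (_ * \det _); apply/matrixP => i k; rewrite !mxE.
  case: splitP => // l; rewrite [l]ord1 => e.
  by case/eqP: (neq_lift i0 i); apply/esym/val_inj; exact: e.
have E w1 : \det (col_mx V w1) = \sum_j w1 0 j * cofactor (col_mx V w) i0 j.
  rewrite (expand_det_row _ i0); apply: eq_bigr => j _.
  by rewrite col_mxEd (C0 w1 w).
rewrite E mxE; apply: eq_bigr => j _; congr (_ * _).
rewrite !mxE E (bigD1 j) //= mxE !eqxx mul1r big1 ?addr0 // => k kj.
by rewrite mxE eqxx (negbTE kj) mul0r.
Qed.

(** The block diagonal matrix with blocks D and 1 acts on V completed by a basis vector. Both the
    effect of conjugation and that of a coordinate change on the normal come from this. *)
Lemma cross_mul (D : 'M[K]_m) V : cross (D *m V) = \det D *: cross V.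
Proof.
apply/rowP => j; rewrite !mxE.
have := @mul_block_col _ m 1 m 1 _ D 0 0 1%:M V (delta_mx 0 j).
rewrite !mul0mx addr0 add0r mul1mx => <-.
by rewrite det_mulmx det_ublock det1 mulr1.
Qed.

Lemma mul_cross_eq0 V : V *m (cross V)^T = 0.
Proof.
apply/matrixP => i j; rewrite [j]ord1 [RHS]mxE.
have -> : (V *m (cross V)^T) i 0 = (row i V *m (cross V)^T) 0 0.
  by rewrite -row_mul [RHS]mxE.
rewrite -det_col_mx_cross; apply: (@determinant_alternate _ _ _ (lshift 1 i) (rshift m 0)).
  by apply/eqP => /(congr1 val) /= e; have := ltn_ord i; rewrite e addn0 ltnn.
by move=> k; rewrite col_mxEu col_mxEd mxE.
Qed.

Variables (G : 'M[K]_(m + 1)) (V : 'M[K]_(m, m + 1)).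
Hypotheses (Gs : G^T = G) (Gu : G \in unitmx) (Vu : V *m G *m V^T \in unitmx).

(** [cross V] is really a linear form; the inverse of G turns it into the vector that represents
    this form for G. *)
Definition normal_vec : 'rV[K]_(m + 1) := cross V *m invmx G.
Local Notation N := normal_vec.

Lemma mul_normal w : (w *m G *m N^T) 0 0 = \det (col_mx V w).
Proof.
rewrite det_col_mx_cross /N trmx_mul trmx_inv Gs -mulmxA (mulmxA G) mulmxV //.
by rewrite mul1mx.
Qed.

Lemma normal_orth : V *m G *m N^T = 0.
Proof.
by rewrite /N trmx_mul trmx_inv Gs -mulmxA (mulmxA G) mulmxV // mul1mx mul_cross_eq0.
Qed.

(** Pairing a relation a V + b w = 0 with the rows of V gives a = 0, their Gram matrix being
    invertible, and then b = 0. A priori w could be isotropic for the indefinite form, so its square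
    must not be divided by here. *)
Lemma det_orth_neq0 w : V *m G *m w^T = 0 -> w != 0 -> \det (col_mx V w) != 0.
Proof.
move=> Vw w0; rewrite -unitfE -unitmxE -row_free_unit.
have K0 (x : 'rV_(m + 1)) : x *m col_mx V w = 0 -> x = 0.
  rewrite -[x]hsubmxK mul_row_col; set a := lsubmx x; set b := rsubmx x => E.
  have wV : w *m G *m V^T = 0.
    by apply: trmx_inj; rewrite !trmx_mul trmxK Gs mulmxA Vw trmx0.
  have a0 : a = 0.
    have : (a *m V + b *m w) *m (G *m V^T) = 0 by rewrite E mul0mx.
    rewrite mulmxDl -!mulmxA [w *m _]mulmxA wV mulmx0 addr0 [V *m _]mulmxA.
    by move/(congr1 (mulmx^~ (invmx (V *m G *m V^T)))); rewrite mulmxK // mul0mx.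
  move: E; rewrite a0 mul0mx add0r [b]mx11_scalar mul_scalar_mx => /eqP.
  rewrite scaler_eq0 (negbTE w0) orbF => /eqP ->.
  by rewrite -scalemx1 scale0r row_mx0.
rewrite -kermx_eq0; apply/eqP/row_matrixP => i; rewrite row0; apply: K0.
by apply/sub_kermxP; exact: row_sub.
Qed.

(** By dimension some nonzero w is orthogonal to V; N pairs with it to a nonzero determinant, so N
    is nonzero. As N is itself orthogonal to V, the same argument with w = N applies to its
    square. *)
Lemma normal_norm_neq0 : bform G N N != 0.
Proof.
have N0 : N != 0.
  have [w Vw w0] : exists2 w : 'rV_(m + 1), V *m G *m w^T = 0 & w != 0.
    have : kermx ((V *m G)^T) != 0.
      rewrite kermx_eq0 /row_free neq_ltn; apply/orP; left.
      by apply: leq_ltn_trans (rank_leq_col _) _; rewrite addn1.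
    move=> /rowV0Pn[w /sub_kermxP Ew w0]; exists w => //.
    by apply: trmx_inj; rewrite trmx_mul trmxK Ew trmx0.
  apply: contraNneq (det_orth_neq0 Vw w0) => N0.
  by rewrite -mul_normal N0 trmx0 mulmx0 mxE.
by rewrite /bform mul_normal; apply: det_orth_neq0 => //; exact: normal_orth.
Qed.

(** The Gram determinant of V completed by N is det(V G V^T) <N, N> by orthogonality, and also <N,
    N>^2 det G, since V completed by N has determinant <N, N>. One factor <N, N> cancels. *)
Lemma normal_norm : bform G N N * \det G = \det (V *m G *m V^T).
Proof.
apply: (mulfI normal_norm_neq0); pose M := col_mx V N.
have dM : \det M = bform G N N by rewrite /bform mul_normal.
have NV : N *m G *m V^T = 0.
  apply: trmx_inj; rewrite 2!trmx_mul trmxK Gs mulmxA trmx0; exact: normal_orth.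
have : \det (M *m G *m M^T) = \det (V *m G *m V^T) * bform G N N.
  rewrite /M tr_col_mx mul_col_mx mul_col_row normal_orth NV det_ublock.
  by congr (_ * _); rewrite det_mx11.
by rewrite !det_mulmx det_tr -!/M dM => e; rewrite mulrC [RHS]mulrC -e mulrC mulrA mulrC.
Qed.

(** The difference of the two sides is orthogonal to V and to N. Its pairing with N is the
    determinant in [det_orth_neq0], so it cannot be nonzero. *)
Lemma orth_normal w : V *m G *m w^T = 0 ->
  w = (bform G w N / bform G N N) *: N.
Proof.
move=> Vw; apply/eqP; rewrite -subr_eq0; set c := _ / _; apply: contraTT isT => w0.
have : \det (col_mx V (w - c *: N)) != 0.
  apply: det_orth_neq0 => //.
  by rewrite linearB linearZ /= mulmxBr Vw -scalemxAr normal_orth scaler0 subr0.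
rewrite -mul_normal mulmxBl mulmxBl -!scalemxAl [X in X != 0]mxE [X in _ + X]mxE.
rewrite [X in _ - X]mxE -/(bform G N N) -/(bform G w N).
by rewrite /c divfK ?subrr ?eqxx // normal_norm_neq0.
Qed.

End CrossProduct.

Lemma map_cross (K K' : fieldType) (f : {rmorphism K -> K'}) (m : nat)
  (V : 'M[K]_(m, m + 1)) : cross (map_mx f V) = map_mx f (cross V).
Proof.
apply/rowP => j; rewrite !mxE -det_map_mx map_col_mx; congr (\det (col_mx _ _)).
by rewrite map_delta_mx.
Qed.

Section UnitNormal.
Context {R : realType} (r : nat).
Local Notation m := (1 + (r + r))%N.
Local Notation n := (m + 1)%N.
Implicit Types (Ph : nat -> 'rV[R[i]]_n) (G : 'M[R]_n).

Definition frame Ph : 'M[R[i]]_(m, n) :=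
  col_mx (Ph 0) (col_mx (\matrix_(i < r) Ph i.+1) (\matrix_(i < r) conjv (Ph i.+1))).

(* Conjugation exchanges the two lower blocks of [frame], so it multiplies the
   cross product by [swap_sign]; the factor [swap_root] makes it real. *)
Definition conj_swap (K : comNzRingType) : 'M[K]_m :=
  block_mx 1%:M 0 0 (block_mx 0 1%:M 1%:M 0).

Lemma mul_conj_swap (K : comNzRingType) (p : nat) (a : 'M[K]_(1, p)) (b c : 'M[K]_(r, p)) :
  conj_swap K *m col_mx a (col_mx b c) = col_mx a (col_mx c b).
Proof. by rewrite !mul_block_col !mul1mx !mul0mx !add0r !addr0. Qed.

Lemma conj_swap2 (K : comNzRingType) : conj_swap K *m conj_swap K = 1%:M.
Proof.
rewrite /conj_swap !mulmx_block !(mul1mx, mulmx1, mul0mx, mulmx0, addr0, add0r).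
by rewrite -!scalar_mx_block.
Qed.

Definition swap_sign : R := \det (conj_swap R).

Lemma swap_sign_sqr : swap_sign = 1 \/ swap_sign = -1.
Proof.
have : swap_sign ^+ 2 == 1 by rewrite expr2 -det_mulmx conj_swap2 det1.
by rewrite sqrf_eq1 => /orP[] /eqP; [left|right].
Qed.

Lemma det_conj_swap : \det (conj_swap (R[i])) = swap_sign%:C.
Proof.
rewrite /swap_sign -(det_map_mx (real_complex R)); congr (\det _).
rewrite /conj_swap !map_block_mx !map_mx0 !map_mx1 //.
Qed.

Lemma conj_frame Ph : conjv (Ph 0) = Ph 0 ->
  map_mx (@conjc R) (frame Ph) = conj_swap (R[i]) *m frame Ph.
Proof.
move=> P0; rewrite /frame mul_conj_swap !map_col_mx -[map_mx _ (Ph 0)]/(conjv _) P0.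
congr (col_mx _ (col_mx _ _)); apply/matrixP => i j; rewrite !mxE //.
exact: conjcK.
Qed.

Definition swap_root : R[i] := if swap_sign == 1 then 1 else 'i%C.

Lemma swap_root_sqr : swap_root * swap_root = swap_sign%:C.
Proof.
rewrite /swap_root; case: eqP => [->|/eqP]; first by rewrite mulr1.
case: swap_sign_sqr => -> ; first by rewrite eqxx.
by move=> _; apply: complexP => /=; ring.
Qed.

Lemma conj_swap_root : conjc swap_root = swap_sign%:C * swap_root.
Proof.
rewrite /swap_root; case: eqP => [->|/eqP]; first by rewrite mulr1 conjc1.
case: swap_sign_sqr => -> ; first by rewrite eqxx.
by move=> _; apply: complexP => /=; ring.
Qed.

Definition hsq G Ph i : R[i] := cform G (Ph i) (conjv (Ph i)).

(** The factor sqrt |det G| brings the square to plus or minus h0, [swap_root] makes the vector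
    real, and the product of the h_i removes the dependence on the coordinate. *)
Definition unit_normal G Ph : 'rV[R[i]]_n :=
  ((Num.sqrt `|\det G|)%:C * swap_root / \prod_(i < r) hsq G Ph i.+1)
  *: normal_vec (complexify G) (frame Ph).

Variables (G : 'M[R]_n) (h0 : R).
Hypotheses (Gs : G^T = G) (Gu : G \in unitmx).

(** These are the pointwise relations among phi_0, ..., phi_r; isolating them makes the study of the
    normal pure linear algebra at one point. *)
Definition isotropic_frame Ph :=
  [/\ conjv (Ph 0) = Ph 0, cform G (Ph 0) (Ph 0) = h0%:C,
      forall i, (i <= r)%N -> hsq G Ph i != 0,
      forall i j, (i <= r)%N -> (j <= r)%N -> i != j -> cform G (Ph i) (conjv (Ph j)) = 0
    & forall i j, (i <= r)%N -> (j <= r)%N -> (0 < i + j)%N -> cform G (Ph i) (Ph j) = 0].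

Lemma complexify_unit : complexify G \in unitmx.
Proof. by rewrite /complexify map_unitmx. Qed.

Lemma complexify_sym : (complexify G)^T = complexify G.
Proof. by rewrite /complexify map_trmx Gs. Qed.

Lemma det_complexify : \det (complexify G) = (\det G)%:C.
Proof. by rewrite /complexify det_map_mx. Qed.

Lemma hsq_conj Ph i : conjc (hsq G Ph i) = hsq G Ph i.
Proof. by rewrite /hsq cform_conj conjvK cform_sym. Qed.

Lemma mulmx_cform (p s : nat) (A : 'M[R[i]]_(p, n)) (B : 'M[R[i]]_(s, n)) i j :
  (A *m complexify G *m B^T) i j = cform G (row i A) (row j B).
Proof.
rewrite /cform /bform -row_mul mxE [RHS]mxE.
by apply: eq_bigr => k _; rewrite !mxE.
Qed.

(** [conj_swap] times the frame is the conjugate frame, so this is the Hermitian Gram matrix, which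
    is diagonal; the bilinear one couples each phi_i with its conjugate. *)
Lemma frame_gram Ph : isotropic_frame Ph ->
  frame Ph *m complexify G *m (conj_swap (R[i]) *m frame Ph)^T =
  block_mx (hsq G Ph 0)%:M 0 0 (block_mx
     (diag_mx (\row_(i < r) hsq G Ph i.+1)) 0 0 (diag_mx (\row_(i < r) hsq G Ph i.+1))).
Proof.
move=> [P0 P00 Hn HH BB]; rewrite mul_conj_swap /frame !tr_col_mx mul_col_mx mul_col_row.
rewrite [X in block_mx X _ _ _ = _](_ : _ = (hsq G Ph 0)%:M); last first.
  by apply/matrixP => i j; rewrite !ord1 mulmx_cform !row_id mxE eqxx mulr1n /hsq P0.
congr block_mx.
- rewrite -row_mx0 mul_mx_row; congr row_mx; apply/matrixP => i j.
    rewrite !ord1 mulmx_cform row_id rowK [RHS]mxE; apply: HH => //.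
  by rewrite !ord1 mulmx_cform row_id rowK [RHS]mxE; apply: BB.
- rewrite -col_mx0 !mul_col_mx; congr col_mx; apply/matrixP => i j.
    by rewrite !ord1 mulmx_cform row_id rowK [RHS]mxE; apply: BB.
  rewrite !ord1 mulmx_cform row_id rowK [RHS]mxE cform_sym //.
  by apply: HH.
rewrite mul_col_mx mul_col_row; congr block_mx; apply/matrixP => i j.
- rewrite mulmx_cform !rowK !mxE; have [->|ij] := eqVneq i j; first by rewrite mulr1n.
  by rewrite mulr0n; apply: HH.
- by rewrite mulmx_cform !rowK [RHS]mxE; apply: BB.
- rewrite mulmx_cform !rowK [RHS]mxE -cform_conj BB ?conjc0 //.
- rewrite mulmx_cform !rowK !mxE cform_sym //; have [->|ij] := eqVneq i j; first by rewrite mulr1n.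
  by rewrite mulr0n; apply: HH => //; rewrite eq_sym.
Qed.

Let Pi Ph := \prod_(i < r) hsq G Ph i.+1.

Lemma Pi_neq0 Ph : isotropic_frame Ph -> Pi Ph != 0.
Proof. by case=> _ _ Hn _ _; apply/prodf_neq0 => i _; apply: Hn. Qed.

Lemma h0_complex_neq0 Ph : isotropic_frame Ph -> (h0%:C : R[i]) != 0.
Proof. by case=> P0 P00 /(_ 0 isT); rewrite /hsq P0 P00. Qed.

Lemma frame_det Ph : isotropic_frame Ph ->
  swap_sign%:C * \det (frame Ph *m complexify G *m (frame Ph)^T) = h0%:C * Pi Ph ^+ 2.
Proof.
move=> iP; have := congr1 (fun M => \det M) (frame_gram iP).
rewrite trmx_mul mulmxA det_mulmx det_tr det_conj_swap mulrC => ->.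
have [P0 P00 _ _ _] := iP.
rewrite !det_ublock det_scalar1 det_diag /hsq P0 P00 expr2; congr (_ * (_ * _));
  by apply: eq_bigr => i _; rewrite mxE.
Qed.

Lemma frame_unit Ph : isotropic_frame Ph ->
  frame Ph *m complexify G *m (frame Ph)^T \in unitmx.
Proof.
move=> iP; rewrite unitmxE unitfE; apply/eqP => E.
have := frame_det iP; rewrite E mulr0 => /esym/eqP.
by rewrite mulf_eq0 expf_eq0 (negbTE (h0_complex_neq0 iP)) (negbTE (Pi_neq0 iP)).
Qed.

Lemma unit_normal_real Ph : isotropic_frame Ph ->
  conjv (unit_normal G Ph) = unit_normal G Ph.
Proof.
move=> iP; have [P0 _ _ _ _] := iP; rewrite /unit_normal conjvZ.
have -> : conjv (normal_vec (complexify G) (frame Ph)) =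
    swap_sign%:C *: normal_vec (complexify G) (frame Ph).
  rewrite /normal_vec /conjv.
  rewrite (map_mxM (@conjc R)) -(map_cross (@conjc R)) conj_frame // cross_mul det_conj_swap.
  rewrite -scalemxAl; congr (_ *: (_ *m _)); rewrite map_invmx; congr invmx.
  by apply/matrixP => i j; rewrite !mxE; exact: conjc_real.
rewrite scalerA; congr (_ *: _).
have -> : forall s k q : R[i], conjc (s * k / q) = conjc s * conjc k / conjc q.
  by move=> s k q; rewrite !rmorphM fmorphV.
rewrite conj_swap_root.
have -> : conjc ((Num.sqrt `|\det G|)%:C) = (Num.sqrt `|\det G|)%:C by exact: conjc_real.
have -> : conjc (\prod_(i < r) hsq G Ph i.+1) = \prod_(i < r) hsq G Ph i.+1.
  by rewrite rmorph_prod; apply: eq_bigr => i _; exact: hsq_conj.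
have s2 : swap_sign%:C * swap_sign%:C = 1 :> R[i].
  by rewrite -rmorphM /=; case: swap_sign_sqr => ->; rewrite ?mulrNN mulr1.
move: (swap_sign%:C) s2 (Num.sqrt _)%:C (swap_root) (\prod_(_ < r) _) => s s2 a b c.
have -> : a * (s * b) / c * s = (s * s) * (a * b / c) by rewrite !mulrA; ring.
by rewrite s2 mul1r.
Qed.

(* The square of the cross product is det (V G V^T) / det G, V being the frame,
   and det (V G V^T) is h0 (h_1 ... h_r)^2 up to [swap_sign]. *)
Definition normal_sign : R := h0 * (`|\det G| / \det G).

Lemma det_neq0 : \det G != 0.
Proof. by rewrite -unitfE -unitmxE. Qed.

Lemma unit_normal_norm Ph : isotropic_frame Ph ->
  cform G (unit_normal G Ph) (unit_normal G Ph) = normal_sign%:C.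
Proof.
move=> iP; rewrite /unit_normal cformZl cformZr.
have D := normal_norm complexify_sym complexify_unit (frame_unit iP).
have E := frame_det iP; rewrite -D det_complexify in E.
have d0 : (\det G)%:C != 0 :> R[i] by rewrite eq_complex /= eqxx andbT det_neq0.
have p0 := Pi_neq0 iP.
have Sq : (Num.sqrt `|\det G|)%:C * (Num.sqrt `|\det G|)%:C = (`|\det G|)%:C :> R[i].
  by rewrite -rmorphM /= -expr2 sqr_sqrtr.
have -> : normal_sign%:C = h0%:C * ((`|\det G|)%:C / (\det G)%:C) :> R[i].
  by rewrite /normal_sign rmorphM /= rmorphM fmorphV.
rewrite -Sq; have K := swap_root_sqr.
move: E K p0 d0; rewrite /Pi.
have -> : bform (complexify G) = cform G by [].
move: (cform _ _ _) (swap_sign%:C) (\prod_(_ < r) _) swap_root (h0%:C) ((\det G)%:C) (Num.sqrt _)%:C.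
move=> c s p k h d a E K p0 d0.
have -> : a * k / p * (a * k / p * c) = a * a * ((k * k) * (c * d)) / (p ^+ 2 * d) by field; rewrite p0 d0.
by rewrite K E; field; rewrite p0 d0.
Qed.

Lemma normal_sign_sqr : h0 = 1 \/ h0 = -1 -> normal_sign = 1 \/ normal_sign = -1.
Proof.
move=> h1; have [e|e] : `|\det G| / \det G = 1 \/ `|\det G| / \det G = -1.
  have d0 := det_neq0; case: (ger0P (\det G)) => _; [left|right].
    by rewrite divff.
  by rewrite mulNr divff.
- by rewrite /normal_sign e mulr1.
by rewrite /normal_sign e mulrN1; case: h1 => ->; rewrite ?opprK; [right|left].
Qed.

Lemma unit_normal_orth Ph w : isotropic_frame Ph ->
  (forall i, (i <= r)%N -> cform G w (Ph i) = 0 /\ cform G w (conjv (Ph i)) = 0) ->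
  exists c, w = c *: unit_normal G Ph.
Proof.
move=> iP Hw; have [P0 _ _ _ _] := iP.
have Vw : frame Ph *m complexify G *m w^T = 0.
  apply/matrixP => i j; rewrite mulmx_cform [RHS]mxE cform_sym //.
  have -> : row j w = w by apply/rowP => k; rewrite mxE ord1.
  rewrite /frame; case: (split_ordP i) => k ->.
    by rewrite rowKu row_id; have [] := Hw 0%N isT.
  rewrite rowKd; case: (split_ordP k) => l ->.
    by rewrite rowKu rowK; have [] := Hw l.+1 (ltn_ord l).
  by rewrite rowKd rowK; have [] := Hw l.+1 (ltn_ord l).
have E := orth_normal complexify_sym complexify_unit (frame_unit iP) Vw.
rewrite /unit_normal; set s := (_ / \prod_(_ < r) _).
have s0 : s != 0.
  rewrite /s !mulf_neq0 ?invr_eq0 ?Pi_neq0 //.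
    by rewrite eq_complex /= eqxx andbT sqrtr_eq0 -ltNge normr_gt0 det_neq0.
  rewrite /swap_root; case: ifP => _; first exact: oner_neq0.
  by rewrite eq_complex /= oner_eq0 andbF.
move: E; move: (_ / bform _ _ _) => t E.
by exists (t / s); rewrite scalerA divfK.
Qed.

Lemma frame_orth_normal Ph i : isotropic_frame Ph -> (i <= r)%N ->
  cform G (Ph i) (unit_normal G Ph) = 0.
Proof.
move=> iP ir; have [P0 _ _ _ _] := iP; rewrite /unit_normal cformZr.
suff -> : cform G (Ph i) (normal_vec (complexify G) (frame Ph)) = 0 by rewrite mulr0.
have := normal_orth (frame Ph) complexify_sym complexify_unit.
case: i ir => [|i] ir.
  move/matrixP/(_ (lshift (r + r) 0) 0); rewrite mulmx_cform [RHS]mxE.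
  by rewrite /frame rowKu !row_id.
move/matrixP/(_ (rshift 1 (lshift r (Ordinal ir))) 0).
by rewrite mulmx_cform [RHS]mxE /frame rowKd rowKu rowK !row_id.
Qed.

(* Each row of the frame is multiplied by c^i or its conjugate, so the cross
   product and the product of the h_i both scale by prod |c|^(2 i). *)
Lemma unit_normal_scale Ph Ps (c : R[i]) : c != 0 ->
  (forall i, (i <= r)%N -> Ps i = c ^+ i *: Ph i) ->
  unit_normal G Ps = unit_normal G Ph.
Proof.
move=> c0 E.
pose D1 : 'rV[R[i]]_r := \row_(i < r) c ^+ i.+1.
pose D2 : 'rV[R[i]]_r := \row_(i < r) conjc (c ^+ i.+1).
pose D := block_mx (1%:M : 'M[R[i]]_1) 0 0 (block_mx (diag_mx D1) 0 0 (diag_mx D2)).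
have eF : frame Ps = D *m frame Ph.
  rewrite /frame !mul_block_col !mul1mx !mul0mx !add0r !addr0; congr (col_mx _ (col_mx _ _)).
  - by rewrite E // expr0 scale1r.
  - by apply/matrixP => i j; rewrite mul_diag_mx !mxE E // mxE.
  - by apply/matrixP => i j; rewrite mul_diag_mx !mxE E // mxE rmorphM.
have dD : \det D = \prod_(i < r) (c ^+ i.+1 * conjc (c ^+ i.+1)).
  rewrite !det_ublock det1 mul1r !det_diag -big_split; apply: eq_bigr => i _.
  by rewrite !mxE.
have eP : \prod_(i < r) hsq G Ps i.+1 = \det D * \prod_(i < r) hsq G Ph i.+1.
  rewrite dD -big_split; apply: eq_bigr => i _ /=.
  by rewrite /hsq E // conjvZ cformZl cformZr mulrA.
have D0 : \det D != 0.
  rewrite dD; apply/prodf_neq0 => i _; rewrite mulf_neq0 ?expf_neq0 //.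
  by rewrite conjc_eq0 expf_neq0.
rewrite /unit_normal eP eF /normal_vec cross_mul -scalemxAl scalerA; congr (_ *: _).
move: (\prod_(_ < r) _) (\det D) D0 (_ * swap_root) => x d d0 y.
by rewrite invfM mulrA mulrAC; congr (_ * _); rewrite divfK.
Qed.

End UnitNormal.

(** * Isothermal coordinates *)

Lemma csmooth_sum (R : realType) (U : set (plane R)) (I : finType) (f : I -> plane R -> R[i]) :
  open U -> (forall i, csmooth U (f i)) -> csmooth U (fun v => \sum_i f i v).
Proof.
move=> oU sf; have [[u Uu]|U0] := pselect (exists u, U u).
  exact: (dz_sum oU sf Uu).1.
by split=> k; apply: Ck_pointwise => u Uu; case: U0; exists u.
Qed.

Lemma csmooth_prod (R : realType) (U : set (plane R)) (I : finType) (f : I -> plane R -> R[i]) :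
  open U -> (forall i, csmooth U (f i)) -> csmooth U (fun v => \prod_i f i v).
Proof.
move=> oU sf.
have -> : (fun v => \prod_i f i v) = (fun v => \prod_(i <- enum I) f i v).
  by apply/funext => v; rewrite big_enum.
elim: (enum I) => [|i s IHs].
  rewrite (_ : (fun v => _) = fun=> 1); last by apply/funext => v; rewrite big_nil.
  exact: csmooth_cst.
have -> : (fun v => \prod_(j <- i :: s) f j v) = (fun v => f i v * \prod_(j <- s) f j v).
  by apply/funext => v; rewrite big_cons.
exact: csmoothM.
Qed.

Lemma csmooth_det (R : realType) (U : set (plane R)) (k : nat) (M : plane R -> 'M[R[i]]_k) :
  open U -> (forall i j, csmooth U (fun v => M v i j)) -> csmooth U (fun v => \det (M v)).
Proof.
move=> oU sM; apply: csmooth_sum => // s; apply: csmoothM => //; first exact: csmooth_cst.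
exact: csmooth_prod.
Qed.

(** The frame enters only through determinants, polynomial in its entries, and through division by
    the non-vanishing h_i. *)
Lemma vsmooth_unit_normal (R : realType) (U : set (plane R)) (r : nat)
  (G : 'M[R]_(1 + (r + r) + 1)) (P : nat -> plane R -> 'rV[R[i]]_(1 + (r + r) + 1)) :
  open U -> (forall i, (i <= r)%N -> vsmooth U (P i)) ->
  (forall i u, (i <= r)%N -> U u -> hsq G (P^~ u) i != 0) ->
  vsmooth U (fun u => unit_normal G (P^~ u)).
Proof.
move=> oU sP Hn; apply: vsmoothZ => //.
  apply: csmoothM => //; first exact: csmooth_cst.
  apply: csmoothV => //; first by move=> u Uu; apply/prodf_neq0 => i _; exact: Hn.
  apply: csmooth_prod => // i; apply: csmooth_cform => //; first exact: sP.
  by apply: vsmooth_conj => //; exact: sP.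
move=> j.
apply: (@csmooth_ext _ _ (fun v => \sum_k
    cross (frame (P^~ v)) 0 k * invmx (complexify G) k j)) => //.
  by move=> v _; rewrite /normal_vec mxE.
apply: csmooth_sum => // k; apply: csmoothM => //; last exact: csmooth_cst.
apply: (@csmooth_ext _ _ (fun v => \det (col_mx (frame (P^~ v)) (delta_mx 0 k)))) => //.
  by move=> v _; rewrite mxE.
apply: csmooth_det => // a b; case: (split_ordP a) => a' ->; last first.
  apply: (@csmooth_ext _ _ (fun v => delta_mx 0 k a' b)) => //; last exact: csmooth_cst.
  by move=> v _; rewrite col_mxEd.
apply: (@csmooth_ext _ _ (fun v => frame (P^~ v) a' b)) => //.
  by move=> v _; rewrite col_mxEu.
rewrite /frame; case: (split_ordP a') => e ->.
  apply: (@csmooth_ext _ _ (fun v => P 0 v 0 b)) => //; last exact: sP.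
  by move=> v _; rewrite col_mxEu ord1.
case: (split_ordP e) => l ->.
  apply: (@csmooth_ext _ _ (fun v => P l.+1 v 0 b)) => //; last exact: sP.
  by move=> v _; rewrite col_mxEd col_mxEu mxE.
apply: (@csmooth_ext _ _ (fun v => conjv (P l.+1 v) 0 b)) => //.
  by move=> v _; rewrite !col_mxEd mxE.
by apply: vsmooth_conj => //; exact: sP.
Qed.

(** The area density equals E in isothermal coordinates, so it cancels inside the divergence. The
    relations are needed on a neighbourhood because they are used under a derivative. *)
Lemma laplace_beltrami_isothermal (R : realType) (U : set (plane R))
  (E F H f : plane R -> R) u : open U -> U u ->
  (forall v, U v -> [/\ 0 < E v, E v = H v & F v = 0]) ->
  laplace_beltrami E F H f u = (dX (dX f) u + dY (dY f) u) / E u.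
Proof.
move=> oU Uu iso; rewrite /laplace_beltrami.
have D v : U v -> Num.sqrt (E v * H v - F v ^+ 2) = E v.
  by move=> /iso[E0 <- ->]; rewrite expr0n subr0 -expr2 sqrtr_sqr gtr0_norm.
congr ((_ + _) / _); last exact: D.
  apply: (dX_eq oU Uu) => v Uv; rewrite D //; have [E0 <- ->] := iso v Uv.
  by rewrite mul0r subr0 mulrC mulKf // gt_eqF.
apply: (dY_eq oU Uu) => v Uv; rewrite D //; have [E0 _ ->] := iso v Uv.
by rewrite mul0r subr0 mulrC mulKf // gt_eqF.
Qed.

Lemma dzb_dz_real (R : realType) (U : set (plane R)) (f : plane R -> R) u :
  open U -> smooth_on U f -> U u ->
  dzb (dz (fun v => (f v)%:C)) u = ((dX (dX f) u + dY (dY f) u) / 4)%:C.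
Proof.
move=> oU sf Uu.
have sX := smooth_dX sf; have sY := smooth_dY sf.
have E v : dz (fun v => (f v)%:C) v = (dX f v / 2) +i* - (dY f v / 2).
  rewrite dzE /= /dX /dY !derive_cst; move: ('D_ _ f v) ('D_ _ f v) => a b.
  by apply: complexP => /=; ring.
have half (g : plane R -> R) v : smooth_on U g -> 'D_v (fun x => g x / 2) u = 'D_v g u / 2.
  move=> sg; rewrite deriveM_diff; [|exact: smooth_diff sg Uu|exact: differentiable_cst].
  by rewrite derive_cst mulr0 addr0.
have halfN (g : plane R -> R) v : smooth_on U g -> 'D_v (fun x => - (g x / 2)) u = - ('D_v g u / 2).
  move=> sg; rewrite -half // (@deriveN _ _ _ (fun x => g x / 2)) //.
  apply: diff_derivable; apply: smooth_diff Uu.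
  by apply: smoothM => //; exact: smooth_cst.
have e : dY (dX f) u = dX (dY f) u by rewrite (dX_dY oU (sf 2%N) Uu).
rewrite dzbE.
have -> : (fun v => complex.Re (dz (fun v => (f v)%:C) v)) = (fun v => dX f v / 2).
  by apply/funext => v; rewrite E.
have -> : (fun v => complex.Im (dz (fun v => (f v)%:C) v)) = (fun v => - (dY f v / 2)).
  by apply/funext => v; rewrite E.
have e1 : dX (fun v => dX f v / 2) u = dX (dX f) u / 2 := half _ _ sX.
have e2 : dY (fun v => dX f v / 2) u = dY (dX f) u / 2 := half _ _ sX.
have e3 : dX (fun v => - (dY f v / 2)) u = - (dX (dY f) u / 2) := halfN _ _ sY.
have e4 : dY (fun v => - (dY f v / 2)) u = - (dY (dY f) u / 2) := halfN _ _ sY.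
rewrite e1 e2 e3 e4 e; move: (dX (dX f) u) (dY (dY f) u) (dX (dY f) u) => a b c.
by apply: complexP => /=; field.
Qed.

Section IsothermalChart.
Context {R : realType} {T : topologicalType} {A : set (chart R T)} {r : nat}.
Local Notation n := (1 + (r + r) + 1)%N.
Context {G : 'M[R]_n} {h0 : R} {phi : T -> 'rV[R]_n}.
Hypotheses (Gs : G^T = G) (Gu : G \in unitmx) (h01 : h0 = 1 \/ h0 = -1).
Hypotheses (hmin : minimal_surface G h0 A phi) (hiso : isotropy G A phi r).
Context {c : chart R T}.
Hypothesis hc : isothermal G A phi c.
Local Notation U := (cimg c).
Local Notation F := (fun u => complexify (phi (cinv c u))).
Local Notation ph := (phi_ G phi c).
Local Notation h := (h_ G phi c).

Lemma chart_h0_neq0 : h0 != 0.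
Proof. by case: h01 => ->; rewrite ?oppr_eq0 oner_eq0. Qed.

Lemma chart_open : open U. Proof. exact: cimg_open. Qed.

Lemma chart_smooth_phi j : smooth_on U (fun u => phi (cinv c u) 0 j).
Proof. by have [sm _ _] := hmin; apply: sm; case: hc. Qed.

Lemma chart_vsmooth : vsmooth U F.
Proof.
move=> j; apply: csmooth_ext (csmooth_real (chart_smooth_phi j)); first exact: chart_open.
by move=> u _; rewrite mxE.
Qed.

Lemma chart_FF u : U u -> cform G (F u) (F u) = h0%:C.
Proof. by move=> Uu; rewrite cform_complexify; have [_ -> _] := hmin. Qed.

(** Vanishing tension means that the ambient Laplacian of phi is a multiple of phi, and in
    isothermal coordinates this Laplacian is 4 / E times phi_{z zb}. *)
Lemma chart_harm : exists mu : plane R -> R[i], forall u, U u ->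
  vdzb (vdz F) u = mu u *: F u.
Proof.
pose f v := phi (cinv c v).
have [Ac isoc] := hc; have [_ _ mc] := hmin.
have K v : U v -> [/\ 0 < ffE G f v, ffE G f v = ffH G f v & ffF G f v = 0].
  move=> Uv; have [eEH F0] := isoc v Uv; split; [|exact: eEH|exact: F0].
  have [imm pos _] := mc c Ac v Uv; rewrite /ffE.
  have := pos 1 0; rewrite scale1r scale0r addr0; apply.
  apply/eqP => X0; have [|/eqP] := imm 1 0; first by rewrite scale1r scale0r addr0 X0.
  by rewrite oner_eq0.
pose L v : 'rV[R]_n := \row_j ((dX (dX (fun v => f v 0 j)) v + dY (dY (fun v => f v 0 j)) v) / ffE G f v).
(* The coefficient of f in the normal part of the Laplacian, times E / 4. *)
exists (fun v => (ffE G f v * (bform G (L v) (f v) / h0) / 4)%:C) => u Uu.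
have [E0 _ _] := K u Uu.
have [_ _ ten] := mc c Ac u Uu.
move: ten; rewrite /tension_field -/f.
have -> : (\row_j laplace_beltrami (ffE G f) (ffF G f) (ffH G f) (fun v => f v 0 j) u) = L u.
  by apply/rowP => j; rewrite !mxE (laplace_beltrami_isothermal _ chart_open Uu).
move=> /subr0_eq EL; apply/rowP => j; rewrite !mxE.
have -> : (fun v => vdz F v 0 j) = dz (fun v => (f v 0 j)%:C).
  apply/funext => v; rewrite mxE; congr (dz _ v); apply/funext => v'; rewrite mxE //.
rewrite (dzb_dz_real chart_open (chart_smooth_phi j) Uu).
have ELj := congr1 (fun M : 'rV[R]_n => M 0 j) EL; rewrite [LHS]mxE [RHS]mxE in ELj.
rewrite -rmorphM /=; congr (_%:C).
have E0' : ffE G f u != 0 by rewrite gt_eqF.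
have XY := divfK E0' (dX (dX (fun v => f v 0 j)) u + dY (dY (fun v => f v 0 j)) u).
rewrite ELj in XY; apply: (etrans (congr1 (fun x => x / 4) (esym XY))).
rewrite -/(f u); move: (bform _ _ _) (f u 0 j) (ffE _ _ _) => a b d; ring.
Qed.

Lemma chart_iso i : (1 <= i <= r)%N -> forall u, U u ->
  h i u != 0 /\ cform G (ph i u) (ph i u) = 0.
Proof. by move=> ir u Uu; have [_ H] := hiso; exact: H. Qed.

Lemma chart_real u : conjv (F u) = F u. Proof. exact: conjv_complexify. Qed.

(** The results on the harmonic sequence are proved for a given [mu]; this supplies one inside each
    proof, while the conclusions stay free of it. *)
Let hsA (P : Prop) (H : forall mu : plane R -> R[i],
  (forall u, U u -> vdzb (vdz F) u = mu u *: F u) -> P) : P.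
Proof. by have [mu Hmu] := chart_harm; exact: H Hmu. Qed.

Lemma chart_vsmooth_ph i : (i <= r.+1)%N -> vsmooth U (ph i).
Proof.
exact: (hs_smooth chart_open chart_vsmooth chart_real chart_h0_neq0 chart_FF chart_iso).
Qed.

Lemma chart_smooth_h i : (i <= r.+1)%N -> csmooth U (h i).
Proof.
exact: (hs_smooth_H chart_open chart_vsmooth chart_real chart_h0_neq0 chart_FF chart_iso).
Qed.

Lemma chart_h_neq0 i u : (i <= r)%N -> U u -> h i u != 0.
Proof. exact: (hs_H_neq0 chart_real chart_h0_neq0 chart_FF chart_iso). Qed.

Lemma chart_B i j u : (i <= r.+1)%N -> (j <= r.+1)%N -> (0 < i + j <= r + r.+1)%N ->
  U u -> cform G (ph i u) (ph j u) = 0.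
Proof.
exact: (hs_B_eq0 Gs chart_open chart_vsmooth chart_real chart_h0_neq0 chart_FF chart_iso).
Qed.

Lemma chart_HH i j u : (i <= r.+1)%N -> (j <= r.+1)%N -> i != j -> U u ->
  cform G (ph i u) (conjv (ph j u)) = 0.
Proof.
apply: hsA => mu Hmu.
exact: (hs_HH_eq0 Gs chart_open chart_vsmooth chart_real chart_h0_neq0 chart_FF chart_iso Hmu).
Qed.

Lemma chart_vdzb i u : (i <= r)%N -> U u ->
  vdzb (ph i.+1) u = - (h i.+1 u / h i u) *: ph i u.
Proof.
apply: hsA => mu Hmu.
exact: (hs_vdzb Gs chart_open chart_vsmooth chart_real chart_h0_neq0 chart_FF chart_iso Hmu).
Qed.

Lemma chart_frame u : U u -> isotropic_frame G h0 (ph^~ u).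
Proof.
move=> Uu; split.
- exact: chart_real.
- exact: chart_FF.
- by move=> i ir; exact: chart_h_neq0.
- by move=> i j ir jr ij; apply: chart_HH => //; exact: leqW.
- move=> i j ir jr ij; apply: chart_B => //; lia.
Qed.

Definition chart_normal u := unit_normal G (ph^~ u).
Local Notation nu := chart_normal.
Local Notation eps := (normal_sign G h0).

Lemma chart_vsmooth_normal : vsmooth U nu.
Proof.
apply: vsmooth_unit_normal; first exact: chart_open.
  by move=> i ir; apply: chart_vsmooth_ph; exact: leqW.
by move=> i u ir Uu; exact: chart_h_neq0.
Qed.

Definition chart_diff u : R[i] := eps%:C * cform G (ph r.+1 u) (nu u).
Local Notation Q := chart_diff.

Lemma eps_sqr : eps%:C * eps%:C = 1 :> R[i].
Proof.
by rewrite -rmorphM /=; case: (normal_sign_sqr Gu h01) => ->; rewrite ?mulrNN mulr1.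
Qed.

Lemma chart_last u : U u -> ph r.+1 u = Q u *: nu u.
Proof.
move=> Uu; have fr := chart_frame Uu.
(* Orthogonality to phi_i is the bilinear relation, whose bound 2r + 1 on the sum of indices allows
   exactly i <= r next to r + 1; orthogonality to conj phi_i is the Hermitian relation. *)
have [k Ek] : exists k, ph r.+1 u = k *: nu u.
  apply: (unit_normal_orth Gs Gu fr) => i ir; split.
    by apply: chart_B => //; [exact: leqW|lia].
  by apply: chart_HH => //; [exact: leqW|rewrite gtn_eqF].
by rewrite /Q Ek cformZl (unit_normal_norm Gs Gu fr) mulrCA eps_sqr mulr1.
Qed.

Lemma chart_h_last u : U u -> h r.+1 u = eps%:C * Q u * conjc (Q u).
Proof.
move=> Uu; have fr := chart_frame Uu.
rewrite /h_ chart_last // conjvZ cformZl cformZr (unit_normal_real Gs fr).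
by rewrite (unit_normal_norm Gs Gu fr) mulrA mulrC mulrA.
Qed.

Lemma chart_smooth_Q : csmooth U Q.
Proof.
apply: csmoothM; [exact: chart_open|exact: csmooth_cst|apply: csmooth_cform].
- exact: chart_open.
- exact: chart_vsmooth_ph.
- exact: chart_vsmooth_normal.
Qed.

Lemma chart_holomorphic : holomorphic_on U Q.
Proof.
have oU := chart_open; have sn := chart_vsmooth_normal.
have sp := chart_vsmooth_ph (leqnn r.+1).
apply: (holomorphic_dzb0 chart_smooth_Q) => u Uu.
rewrite (dzbM oU (csmooth_cst _ _) (csmooth_cform G oU sp sn) Uu) dzb_cst mul0r add0r.
rewrite (dzb_cform G oU sp sn Uu) chart_vdzb // cformZl.
rewrite (frame_orth_normal Gs Gu (chart_frame Uu)) // mulr0 add0r.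
rewrite chart_last // cformZl.
suff -> : cform G (nu u) (vdzb nu u) = 0 by rewrite !mulr0.
have N v : U v -> cform G (nu v) (nu v) = eps%:C.
  by move=> Uv; exact: (unit_normal_norm Gs Gu (chart_frame Uv)).
have := dzb_cform G oU sn sn Uu; rewrite (dzb_eq0 oU N Uu).
rewrite [cform G (vdzb _ _) _]cform_sym // -mulr2n => /esym/eqP.
by rewrite mulrn_eq0 /= => /eqP.
Qed.

Lemma chart_h_real i u : h i u = (complex.Re (h i u))%:C.
Proof.
have := cform_conj G (ph i u) (conjv (ph i u)); rewrite conjvK [RHS]cform_sym //.
rewrite -/(h i u); case: (h i u) => a b [] e; congr (_ +i* _).
have /eqP : b *+ 2 = 0 by rewrite mulr2n -[X in X + _]e addNr.
by rewrite mulrn_eq0 => /eqP.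
Qed.

(* 4^-1 ln (h^2) stands for 2^-1 ln |h|, avoiding to differentiate a norm. *)
Definition log_h i u : R := 4^-1 * ln (complex.Re (h i u) ^+ 2).

Lemma chart_Re_h_neq0 i u : (i <= r)%N -> U u -> complex.Re (h i u) != 0.
Proof.
move=> ir Uu; have := chart_h_neq0 ir Uu; apply: contra => /eqP e.
by rewrite chart_h_real e.
Qed.

Lemma chart_smooth_sqr i : (i <= r)%N ->
  smooth_on U (fun u => complex.Re (h i u) ^+ 2).
Proof.
move=> ir; have [s _] := chart_smooth_h (leqW ir).
apply: smooth_ext (smoothM chart_open s s); first exact: chart_open.
by move=> u _; rewrite expr2.
Qed.

Lemma chart_smooth_log i : (i <= r)%N -> smooth_on U (log_h i).
Proof.
move=> ir; apply: smoothM; [exact: chart_open|exact: smooth_cst|] => k.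
apply: Ck_ln; [exact: chart_open| |exact: chart_smooth_sqr].
by move=> u Uu; rewrite exprn_even_gt0 //= chart_Re_h_neq0.
Qed.

Lemma chart_exp_log i u : (i <= r)%N -> U u ->
  expR (2 * log_h i u) = `|complex.Re (h i u)|.
Proof.
move=> ir Uu; have n0 : 0 < `|complex.Re (h i u)| by rewrite normr_gt0 chart_Re_h_neq0.
rewrite /log_h -real_normK ?num_real // lnXn //; move: `|_| n0 => x x0.
rewrite -[RHS](lnK x0); congr expR; by move: (ln x) => y; field.
Qed.

Lemma chart_toda i u : (1 <= i <= r)%N -> U u ->
  2 * dzb (dz (fun v => (log_h i v)%:C)) u = h i.+1 u / h i u - h i u / h i.-1 u.
Proof.
move=> /andP[i1 ir] Uu; have oU := chart_open.
have sh := chart_smooth_h (leqW ir).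
have sa : csmooth U (hs_coeff G F i).
  exact: (hs_smooth_a chart_open chart_vsmooth chart_real chart_h0_neq0 chart_FF chart_iso).
have E v : U v -> dz (fun v => (log_h i v)%:C) v = 2^-1 * hs_coeff G F i v.
  move=> Uv.
  have D : dz (h i) v = hs_coeff G F i v * h i v.
    apply: hsA => mu Hmu.
    exact: (hs_dz_H Gs chart_open chart_vsmooth chart_real chart_h0_neq0 chart_FF chart_iso Hmu).
  pose g v := complex.Re (h i v) ^+ 2.
  have sg : smooth_on U g by exact: chart_smooth_sqr.
  have g0 : 0 < g v by rewrite exprn_even_gt0 //= chart_Re_h_neq0.
  (* As h_i is real, its real square is a complex product, so g_z = 2 a_i g and a quarter of its
     logarithmic derivative is a_i / 2. *)
  have gE : (fun v => (g v)%:C) = (fun v => h i v * h i v).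
    by apply/funext => y; rewrite chart_h_real -rmorphM /= -expr2.
  have sl : csmooth U (fun v => (ln (g v))%:C).
    apply: csmooth_real => k; apply: Ck_ln; [exact: oU| |exact: sg].
    by move=> y Uy; rewrite exprn_even_gt0 //= chart_Re_h_neq0.
  have -> : (fun v => (log_h i v)%:C) = (fun v => (4^-1)%:C * (ln (g v))%:C).
    by apply/funext => y; rewrite -rmorphM.
  rewrite (dzM oU (csmooth_cst _ _) sl Uv) dz_cst mul0r add0r (dz_ln sg Uv g0) gE.
  rewrite (dzM oU sh sh Uv) D.
  have -> : (g v)%:C = h i v * h i v by rewrite -[RHS]/((fun v => h i v * h i v) v) -gE.
  have := chart_h_neq0 ir Uv.
  have -> : (4^-1)%:C = 4^-1 :> R[i] by rewrite fmorphV rmorph_nat.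
  by move: (h i v) (hs_coeff _ _ _ _) => x y x0; field.
rewrite (dzb_ext oU E Uu) (dzbM oU (csmooth_cst _ _) sa Uu) dzb_cst mul0r add0r mulrA.
rewrite divff ?pnatr_eq0 // mul1r; apply: hsA => mu Hmu.
apply: (hs_toda Gs chart_open chart_vsmooth chart_real chart_h0_neq0 chart_FF chart_iso Hmu) => //.
by rewrite i1.
Qed.

End IsothermalChart.

Arguments chart_normal {R T r} G phi c u.
Arguments chart_diff {R T r} G h0 phi c u.
Arguments log_h {R T r} G phi c i u.

(** * Changes of coordinates *)

Section ChangeOfVariable.
Context {R : realType} {n : nat}.
Implicit Types (U V : set (plane R)) (F : plane R -> 'rV[R[i]]_n) (g : plane R -> plane R).

Lemma vdz_comp U V F g u : open U ->
  smooth_on U (fun u => (g u).1) -> smooth_on U (fun u => (g u).2) ->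
  vsmooth V F -> (forall u, U u -> V (g u)) -> U u ->
  dzb (fun v => toC (g v)) u = 0 ->
  vdz (fun v => F (g v)) u = dz (fun v => toC (g v)) u *: vdz F (g u).
Proof.
move=> oU g1 g2 sF UV Uu g0; apply/rowP => j; rewrite !mxE mulrC.
exact: (dz_comp oU g1 g2 (sF j) UV Uu g0).1.
Qed.

Lemma vsmooth_comp U V F g : open U ->
  smooth_on U (fun u => (g u).1) -> smooth_on U (fun u => (g u).2) ->
  vsmooth V F -> (forall u, U u -> V (g u)) -> vsmooth U (fun v => F (g v)).
Proof. by move=> oU g1 g2 sF UV j; exact: csmooth_comp oU g1 g2 (sF j) UV. Qed.

Lemma csmoothX U (f : plane R -> R[i]) k : open U -> csmooth U f ->
  csmooth U (fun v => f v ^+ k).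
Proof.
move=> oU sf; elim: k => [|k IH].
  by apply: (@csmooth_ext _ _ (fun=> 1)) => //; exact: csmooth_cst.
apply: csmooth_ext (csmoothM oU sf IH) => // u _; by rewrite exprS.
Qed.

End ChangeOfVariable.

Lemma overlap_open (R : realType) (T : topologicalType) (c d : chart R T) :
  open (overlap c d).
Proof.
rewrite openE => u [cu du]; apply: filterI.
  by apply: open_nbhs_nbhs; split => //; exact: cimg_open.
apply: (cinv_cont cu); apply: open_nbhs_nbhs; split => //; exact: cdom_open.
Qed.

Section TwoCharts.
Context {R : realType} {T : topologicalType} {A : set (chart R T)} {r : nat}.
Local Notation n := (1 + (r + r) + 1)%N.
Context {G : 'M[R]_n} {h0 : R} {phi : T -> 'rV[R]_n}.
Hypotheses (Gs : G^T = G) (Gu : G \in unitmx) (h01 : h0 = 1 \/ h0 = -1).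
Hypotheses (hmin : minimal_surface G h0 A phi) (hiso : isotropy G A phi r).
Hypothesis compatA : forall c d, A c -> A d -> oriented_compat c d.
Hypothesis hC : complex_atlas (isothermal G A phi).
Context {c d : chart R T}.
Hypotheses (hc : isothermal G A phi c) (hd : isothermal G A phi d).
Local Notation V := (overlap c d).
Local Notation g := (trans c d).
Local Notation phc := (phi_ G phi c).
Local Notation phd := (phi_ G phi d).

Definition trans_dz u : R[i] := dz (fun v => toC (g v)) u.
Local Notation g' := trans_dz.

Lemma overlap_cimg u : V u -> cimg c u. Proof. by case. Qed.

Lemma trans_cimg u : V u -> cimg d (g u).
Proof. by case=> cu du; exact: cmap_img. Qed.

Lemma trans_smooth : smooth_on V (fun u => (g u).1) /\ smooth_on V (fun u => (g u).2).
Proof. by have [s1 s2 _] := compatA hc.1 hd.1. Qed.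

Lemma csmooth_trans : csmooth V (fun v => toC (g v)).
Proof. by have [s1 s2] := trans_smooth; split. Qed.

Lemma trans_dzb0 u : V u -> dzb (fun v => toC (g v)) u = 0.
Proof. by move=> Vu; have [] := holomorphic_dz csmooth_trans (hC.2 c d hc hd) Vu. Qed.

Lemma trans_cderiv u : V u -> cderiv (fun v => toC (g v)) u = g' u.
Proof. by move=> Vu; have [] := holomorphic_dz csmooth_trans (hC.2 c d hc hd) Vu. Qed.

Lemma trans_dz_neq0 u : V u -> g' u != 0.
Proof.
move=> Vu; apply: jacobian_holomorphic; first exact: trans_dzb0.
by have [_ _ J] := compatA hc.1 hd.1; exact: J.
Qed.

Lemma csmooth_trans_dz : csmooth V g'.
Proof. by apply: csmooth_dz; [exact: overlap_open|exact: csmooth_trans]. Qed.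

(** In the induction step, differentiating produces the expected multiple of phi_{i+1} plus a
    remainder b phi_i, where b contains second derivatives of the coordinate change and both
    coefficients a_i. *)
Lemma phi_change i u : (i <= r.+1)%N -> V u -> phc i u = g' u ^+ i *: phd i (g u).
Proof.
have oV : open V by exact: overlap_open.
have [s1 s2] := trans_smooth.
elim: i u => [|i IH] u ir Vu.
  rewrite expr0 scale1r /phi_ /= /trans cmapK //; exact: Vu.2.
have ir' : (i <= r.+1)%N by exact: ltnW.
have sd := chart_vsmooth_ph h01 hmin hiso hd ir'.
have sdg := vsmooth_comp oV s1 s2 sd trans_cimg.
have sgi := csmoothX i oV csmooth_trans_dz.
pose b := dz (fun v => g' v ^+ i) u + g' u ^+ i.+1 * hs_coeff G (fun u => complexify (phi (cinv d u))) i (g u)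
  - hs_coeff G (fun u => complexify (phi (cinv c u))) i u * g' u ^+ i.
have E : phc i.+1 u = g' u ^+ i.+1 *: phd i.+1 (g u) + b *: phd i (g u).
  rewrite {1}/phi_ hs_succ -/(phi_ G phi c i).
  rewrite (vdz_ext oV (fun v Vv => IH v ir' Vv) Vu) (vdzZ oV sgi sdg Vu).
  rewrite (vdz_comp oV s1 s2 sd trans_cimg Vu (trans_dzb0 Vu)) -/(g' u).
  rewrite {2}/phi_ hs_vdz -/(phi_ G phi d i.+1) -/(phi_ G phi d i).
  rewrite IH // /b exprSr.
  move: (phd i.+1 (g u)) (phd i (g u)) (dz _ u) (hs_coeff _ _ _ _) (hs_coeff _ _ _ _) (g' u) (g' u ^+ i).
  move=> x y p q s t k; rewrite !scalerDr !scalerDl !scalerA scaleNr -!addrA.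
  by rewrite addrCA.
(* Instead of computing b, pair with conj phi_i: in both coordinates phi_{i+1} is orthogonal to it,
   and h_i and g' have no zero, so b = 0. *)
suff b0 : b = 0 by rewrite E b0 scale0r addr0.
have n0 : g' u ^+ i != 0 by rewrite expf_neq0 // trans_dz_neq0.
have ne : i.+1 != i by rewrite gtn_eqF.
have := chart_HH Gs h01 hmin hiso hc ir ir' ne (overlap_cimg Vu).
rewrite E IH // conjvZ cformDl !cformZl !cformZr.
rewrite (chart_HH Gs h01 hmin hiso hd ir ir' ne (trans_cimg Vu)) !mulr0 add0r.
rewrite -/(h_ G phi d i (g u)) => /eqP; rewrite !mulf_eq0 conjc_eq0 (negbTE n0).
by rewrite (negbTE (chart_h_neq0 h01 hmin hiso hd ir (trans_cimg Vu))) !orbF => /eqP.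
Qed.

Lemma h_change i u : (i <= r.+1)%N -> V u ->
  h_ G phi c i u = g' u ^+ i * conjc (g' u ^+ i) * h_ G phi d i (g u).
Proof. by move=> ir Vu; rewrite /h_ phi_change // conjvZ cformZl cformZr mulrA. Qed.

Lemma normal_change u : V u -> chart_normal G phi c u = chart_normal G phi d (g u).
Proof.
move=> Vu; apply: (unit_normal_scale G (trans_dz_neq0 Vu)) => i ir.
by apply: phi_change => //; exact: leqW.
Qed.

Lemma diff_change u : V u ->
  chart_diff G h0 phi c u = chart_diff G h0 phi d (g u) * cderiv (fun v => toC (g v)) u ^+ r.+1.
Proof.
move=> Vu; rewrite trans_cderiv // /chart_diff normal_change // phi_change // cformZl.
by rewrite mulrCA mulrC.
Qed.

Lemma h_sign_change i u (s : R) : (i <= r)%N -> V u ->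
  0 < s * complex.Re (h_ G phi d i (g u)) -> 0 < s * complex.Re (h_ G phi c i u).
Proof.
move=> ir Vu H; rewrite h_change //; last exact: leqW.
have n0 : g' u ^+ i != 0 by rewrite expf_neq0 // trans_dz_neq0.
rewrite (chart_h_real Gs (c := d) i (g u)).
have := complex_sqr_neq0 n0; case: (g' u ^+ i) => a b /= k0.
have k1 : 0 < a ^+ 2 + b ^+ 2 by rewrite lt_def k0 addr_ge0 // sqr_ge0.
rewrite (_ : s * _ = (a ^+ 2 + b ^+ 2) * (s * complex.Re (h_ G phi d i (g u)))).
  by rewrite mulr_gt0.
by move: (complex.Re _) => x; ring.
Qed.

End TwoCharts.

(** * Constancy of signs and gluing over the surface *)

Lemma connected_dichotomy (T : topologicalType) (P N : set T) : connected [set: T] ->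
  open P -> open N -> (forall x, P x \/ N x) -> (forall x, P x -> N x -> False) ->
  (forall x, P x) \/ (forall x, N x).
Proof.
move=> cT oP oN PN dis; have [[x Px]|nP] := pselect (exists x, P x); last first.
  by right=> x; case: (PN x) => // Px; case: nP; exists x.
left=> y; suff -> : P = [set: T] by [].
apply: cT; first by exists x.
  by exists P; rewrite ?setTI.
exists (~` N); first exact: open_closedC.
rewrite setTI; apply/seteqP; split=> z /=; first by move=> Pz Nz; exact: dis Pz Nz.
by move=> Nz; case: (PN z).
Qed.

Section Global.
Context {R : realType} {T : topologicalType} {A : set (chart R T)} {r : nat}.
Local Notation n := (1 + (r + r) + 1)%N.
Context {G : 'M[R]_n} {h0 : R} {phi : T -> 'rV[R]_n}.
Hypotheses (Gs : G^T = G) (Gu : G \in unitmx) (h01 : h0 = 1 \/ h0 = -1).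
Hypotheses (hmin : minimal_surface G h0 A phi) (hiso : isotropy G A phi r).
Hypothesis hS : connected_oriented_surface A.
Hypothesis hC : complex_atlas (isothermal G A phi).
Local Notation iso := (isothermal G A phi).
Local Notation h := (h_ G phi).

Lemma atlas_compat c d : A c -> A d -> oriented_compat c d.
Proof. by have [_ _ _ [_ H _]] := hS; exact: H. Qed.

(** Asking for some chart makes openness immediate; [h_sign_change] shows that any isothermal chart
    around the point then gives the same sign. *)
Definition sign_set i (s : R) : set T :=
  [set x | exists c, [/\ iso c, cdom c x & 0 < s * complex.Re (h c i (cmap c x))]].

Lemma sign_set_open i s : (i <= r)%N -> open (sign_set i s).
Proof.
move=> ir; rewrite openE => x [c [hc cx sx]].
have [sm _] := chart_smooth_h h01 hmin hiso hc (leqW ir).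
have cu := cmap_img cx.
have k1 : {for x, continuous (fun y => complex.Re (h c i (cmap c y)))} :=
  @continuous_comp _ _ _ (cmap c) (fun v => complex.Re (h c i v)) x (cmap_cont cx) (sm 0%N _ cu).
have C : {for x, continuous (fun y => s * complex.Re (h c i (cmap c y)))}.
  by apply: cvgM; [exact: cvg_cst|exact: k1].
have N1 : nbhs x (cdom c) by apply: open_nbhs_nbhs; split=> //; exact: cdom_open.
have N0 : nbhs (s * complex.Re (h c i (cmap c x))) [set z : R | 0 < z].
  by apply: open_nbhs_nbhs; split=> //; exact: open_gt.
have N2 : nbhs x [set y | 0 < s * complex.Re (h c i (cmap c y))] := C _ N0.
by apply: filterS (filterI N1 N2) => y [cy sy]; exists c.
Qed.

Lemma sign_set_chart i s c u : (i <= r)%N -> iso c -> cimg c u ->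
  sign_set i s (cinv c u) -> 0 < s * complex.Re (h c i u).
Proof.
move=> ir hc cu [d [hd du sd]].
by apply: (h_sign_change Gs h01 hmin hiso atlas_compat hC hc hd ir _ sd).
Qed.

(** The bound on i sits inside the conclusion so that a sequence of signs indexed by all naturals
    can be chosen; beyond r the value is 1 by default. *)
Lemma h_sign i : exists s : R, (s = 1 \/ s = -1) /\ ((i <= r)%N ->
  forall c, iso c -> forall u, cimg c u -> h c i u = (s * `|complex.Re (h c i u)|)%:C).
Proof.
have [ir|] := leqP i r; last by exists 1; split=> //; left.
suff [s [s1 Hs]] : exists s : R, (s = 1 \/ s = -1) /\ forall x, sign_set i s x.
  exists s; split=> // _ c hc u cu.
  have x0 := sign_set_chart ir hc cu (Hs _).
  rewrite {1}(chart_h_real Gs (c := c) i u); move: (complex.Re _) x0 => x.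
  case: s1 => ->; rewrite ?mul1r ?mulN1r ?oppr_gt0 => x0; congr (_%:C).
    by rewrite gtr0_norm.
  by rewrite ltr0_norm // opprK.
have [_ _ cT _] := hS.
have [x|x [c [hc cx s1]]||] := connected_dichotomy cT (sign_set_open 1 ir) (sign_set_open (-1) ir).
- have [c hc cx] := hC.1 x; have cu := cmap_img cx.
  have := chart_Re_h_neq0 Gs h01 hmin hiso hc ir cu; rewrite neq_lt => /orP[] H.
    by right; exists c; split=> //; rewrite mulN1r oppr_gt0.
  by left; exists c; split=> //; rewrite mul1r.
- have cu := cmap_img cx; rewrite -[x](cmapK cx) => /(sign_set_chart ir hc cu).
  by rewrite mulN1r oppr_gt0 => /lt_trans/(_ s1); rewrite mul1r ltxx.
- by move=> H; exists 1; split; [left|].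
- by move=> H; exists (-1); split; [right|].
Qed.

(** An isothermal chart is chosen arbitrarily at each point, with no continuity in the choice;
    [normal_change] makes the resulting vector independent of it. *)
Lemma global_normal : exists phit : T -> 'rV[R]_n,
  [/\ smooth_map A phit, forall x, bform G (phit x) (phit x) = normal_sign G h0
    & forall c, iso c -> forall u, cimg c u ->
        complexify (phit (cinv c u)) = chart_normal G phi c u].
Proof.
have H0 (x : T) : exists c, iso c /\ cdom c x by have [c hc cx] := hC.1 x; exists c.
have [ch Hch] := choice H0.
pose re (v : 'rV[R[i]]_n) : 'rV[R]_n := map_mx (fun z : R[i] => complex.Re z) v.
pose phit x := re (chart_normal G phi (ch x) (cmap (ch x) x)).
have reK (v : 'rV[R[i]]_n) : conjv v = v -> complexify (re v) = v.
  move=> vr; apply/rowP => j; rewrite !mxE; have := congr1 (fun M : 'rV[R[i]]_n => M 0 j) vr.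
  rewrite mxE; case: (v 0 j) => a b [e]; congr (_ +i* _).
  have /eqP : b *+ 2 = 0 by rewrite mulr2n -[X in X + _]e addNr.
  by rewrite mulrn_eq0 => /eqP.
have nr c u : iso c -> cimg c u -> conjv (chart_normal G phi c u) = chart_normal G phi c u.
  move=> hc cu; exact: (unit_normal_real Gs (chart_frame Gs Gu h01 hmin hiso hc cu)).
have key c u : iso c -> cimg c u -> phit (cinv c u) = re (chart_normal G phi c u).
  move=> hc cu; have [hd du] := Hch (cinv c u).
  have E := normal_change Gs h01 hmin hiso atlas_compat hC hc hd (conj cu du).
  by rewrite E.
exists phit; split.
(* Here c is any chart of the oriented atlas: near u, [phit] is the smooth normal of an isothermal
   chart d composed with the smooth transition from c to d. *)
- move=> c Ac j k; apply: Ck_pointwise => u cu.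
  have [d hd du] := hC.1 (cinv c u); have Vu : overlap c d u by [].
  have [s1 s2 _] := atlas_compat Ac hd.1.
  have UV v : overlap c d v -> cimg d (trans c d v) by case=> cv dv; exact: cmap_img.
  have sn := chart_vsmooth_normal h01 hmin hiso hd j.
  have [sr _] := csmooth_comp (@overlap_open _ _ c d) s1 s2 sn UV.
  apply: (@Ck_sub _ _ (overlap c d)); first by move=> v ->.
  apply: Ck_ext (@overlap_open _ _ c d) _ (sr k) => v Vv.
  have := key d (trans c d v) hd (UV v Vv).
  rewrite /trans cmapK; last exact: Vv.2.
  by move=> ->; rewrite [RHS]mxE.
- move=> x; have [hc cx] := Hch x; have cu := cmap_img cx.
  apply: complexI; rewrite -cform_complexify -{1 2}[x](cmapK cx) key // reK ?nr //.
  exact: (unit_normal_norm Gs Gu (chart_frame Gs Gu h01 hmin hiso hc cu)).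
- by move=> c hc u cu; rewrite key // reK // nr.
Qed.

End Global.

Lemma signature_sym_unit (R : realType) (p q : nat) (G : 'M[R]_(p + q)) :
  has_signature G -> G^T = G /\ G \in unitmx.
Proof.
case=> P Pu ->; split; first by rewrite !trmx_mul trmxK tr_diag_mx mulmxA.
rewrite !unitmx_mul unitmx_tr Pu /= andbT unitmxE det_diag unitfE.
by apply/prodf_neq0 => j _; rewrite mxE; case: ifP; rewrite ?oppr_eq0 oner_eq0.
Qed.


Theorem mainTheorem14 (R : realType) (T : topologicalType)
  (A : set (chart R T)) (p q r : nat) (G : 'M[R]_(p + q)) (h0 : R)
  (phi : T -> 'rV[R]_(p + q))
  (hS : connected_oriented_surface A)
  (hG : has_signature G)
  (hh0 : h0 = 1 \/ h0 = - 1)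
  (hr : (1 <= r)%N)
  (hpq : (p + q = 2 * r + 2)%N)
  (hC : complex_atlas (isothermal G A phi))
  (hphi : superconformal G h0 A phi r \/ superminimal G h0 A phi r) :
  exists (eps : R) (phit : T -> 'rV[R]_(p + q))
    (Q : chart R T -> plane R -> R[i])
    (eps_ : nat -> R) (w : chart R T -> nat -> plane R -> R),
  [/\ (eps = 1 \/ eps = - 1) /\ smooth_map A phit /\
        (forall x, bform G (phit x) (phit x) = eps),
      forall c, isothermal G A phi c -> forall u, cimg c u ->
        phi_ G phi c r.+1 u = Q c u *: complexify (phit (cinv c u)) /\
        h_ G phi c r.+1 u = eps%:C * Q c u * conjc (Q c u),
      holomorphic_differential (isothermal G A phi) r.+1 Q,
      (forall i, (1 <= i <= r)%N -> eps_ i = 1 \/ eps_ i = - 1) /\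
      (forall c, isothermal G A phi c ->
        (forall i, (1 <= i <= r)%N ->
           smooth_on (cimg c) (w c i) /\
           forall u, cimg c u ->
             h_ G phi c i u = (eps_ i * expR (2 * w c i u))%:C) /\
        (forall i, (1 <= i <= r.-1)%N -> forall u, cimg c u ->
           2 * dzb (dz (fun v => (w c i v)%:C)) u =
             h_ G phi c i.+1 u / h_ G phi c i u
             - h_ G phi c i u / h_ G phi c i.-1 u) /\
        (forall u, cimg c u ->
           2 * dzb (dz (fun v => (w c r v)%:C)) u =
             eps%:C * Q c u * conjc (Q c u) / h_ G phi c r u
             - h_ G phi c r u / h_ G phi c r.-1 u))
    & superminimal G h0 A phi r <->
        (forall c, isothermal G A phi c -> forall u, cimg c u -> Q c u = 0)].
Proof.
have [Gs Gu] := signature_sym_unit hG.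
have hmin : minimal_surface G h0 A phi by case: hphi => -[].
have hiso : isotropy G A phi r by case: hphi => -[].
have e : (p + q = 1 + (r + r) + 1)%N by lia.
(* The dimension is put in the shape of the frame: one row for phi_0, r rows for each of the two
   blocks, and one more for the normal. *)
move: {hG} G phi hC hphi Gs Gu hmin hiso hpq; rewrite e => {e} G phi hC hphi Gs Gu hmin hiso hn.
have [phit [sm nrm key]] := global_normal Gs Gu hh0 hmin hiso hS hC.
have [eps_ Heps] := choice (h_sign Gs hh0 hmin hiso hS hC).
exists (normal_sign G h0), phit, (chart_diff G h0 phi), eps_, (log_h G phi).
have last c u (hc : isothermal G A phi c) (cu : cimg c u) :=
  chart_h_last Gs Gu hh0 hmin hiso hc cu.
split.
- by split; [exact: normal_sign_sqr|split].
- move=> c hc u cu; split; last exact: last.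
  by rewrite key //; exact: (chart_last Gs Gu hh0 hmin hiso hc cu).
- split=> [c hc|c d hc hd u Vu]; first exact: (chart_holomorphic Gs Gu hh0 hmin hiso hc).
  exact: (diff_change Gs hh0 hmin hiso (atlas_compat hS) hC hc hd Vu).
- split=> [i _|c hc]; first by have [] := Heps i.
  split=> [i /andP[_ ir]|].
    split; first exact: (chart_smooth_log Gs hh0 hmin hiso hc ir).
    move=> u cu; rewrite (chart_exp_log Gs hh0 hmin hiso hc ir cu).
    by have [_ H] := Heps i; exact: H.
  split=> [i /andP[i1 ir] u cu|u cu].
    by apply: (chart_toda Gs hh0 hmin hiso hc) cu; lia.
  (* Restoring h_{r+1} in place of eps q conj(q) makes the last equation the case i = r of the
     general one. *)
  rewrite -last //; apply: (chart_toda Gs hh0 hmin hiso hc) cu.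
  by rewrite hr /=.
(* Since h_{r+1} is eps times the squared modulus of q, and eps is nonzero, the two vanish
   together. *)
- split=> [[_ _ _ h0r] c hc u cu|Q0].
    have := last c u hc cu; rewrite h0r //; move: (chart_diff _ _ _ c u) => x.
    move=> /esym/eqP; rewrite !mulf_eq0 conjc_eq0 -orbA orbb => /orP[] /eqP // en.
    by have /eqP := eps_sqr Gu hh0; rewrite en mul0r eq_sym oner_eq0.
  split=> //; first by left.
  by move=> c hc u cu; rewrite last // Q0 // mulr0 mul0r.
Qed.
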